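(* The sequences $\mathcal{G}_n^{\pm}$ converge uniformly on compact subsets of $M\times\mathbb{C}^2$, as $n\to\infty$, to a continuous plurisubharmonic function $\mathcal{G}^{\pm}$ on $M\times\mathbb{C}^2$ that satisfies $$d\,\mathcal{G}^{\pm}=\mathcal{G}^{\pm}\circ H^{\pm1}.$$ The functions $\mathcal{G}^{\pm}$ are positive on $(M\times\mathbb{C}^2)\setminus\mathcal{K}^{\pm}$ and vanish precisely on $\mathcal{K}^{\pm}$.
   Context: $M$ is a compact subset of $\mathbb{C}^k$, $k\ge1$, and $\sigma:M\to M$ is a homeomorphism. Fix $m\ge1$ and integers $d_1,\dots,d_m\ge2$, and put $d=d_1\cdots d_m$. For $\lambda\in M$ and $1\le j\le m$ let $H_\lambda^{(j)}(x,y)=(y,\,p_{j,\lambda}(y)-a_j(\lambda)x)$ on $\mathbb{C}^2$, where $p_{j,\lambda}$ is a monic polynomial of degree $d_j$ whose coefficients are continuous functions of $\lambda\in M$ and $a_j$ is a continuous nowhere vanishing function on $M$; let $H_\lambda=H_\lambda^{(m)}\circ\cdots\circ H_\lambda^{(1)}$. Let $H:M\times\mathbb{C}^2\to M\times\mathbb{C}^2$, $H(\lambda,x,y)=(\sigma(\lambda),H_\lambda(x,y))$, which is invertible; $H^{\pm n}$ denotes the $n$-fold iterate of $H^{\pm1}$. For $n\ge0$ define $\mathcal{G}_n^{\pm}(\lambda,x,y)=\frac1{d^n}\log^+\|H^{\pm n}(\lambda,x,y)\|$ (norm in $\mathbb{C}^k\times\mathbb{C}^2$, $\log^+t=\max\{\log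 t,0\}$) and $\mathcal{K}^{\pm}=\{(\lambda,z)\in M\times\mathbb{C}^2:\ (H^{\pm n}(\lambda,z))_{n\ge0}\text{ is bounded in }M\times\mathbb{C}^2\}$.
   Formalization: ''Plurisubharmonic on M×C²'' is taken as plurisubharmonic on each fibre {λ}×C² (with joint continuity), since M has no complex structure and joint plurisubharmonicity fails for coefficients only continuous in λ. *)

(* Defs.v *)
From HB Require Import structures.
From mathcomp Require Import all_boot all_order all_algebra.
From mathcomp Require Export all_classical all_reals all_analysis.
From mathcomp Require Export complex.

Set Implicit Arguments.
Unset Strict Implicit.
Unset Printing Implicit Defensive.

Import Order.TTheory GRing.Theory Num.Theory.
Import numFieldNormedType.Exports.

Local Open Scope classical_set_scope.
Local Open Scope ring_scope.

(* [R[i]^o] is [R[i]] equipped with the topology of its norm; [R[i]] itself has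
   no canonical topology. *)
Notation CC R := (R[i]^o).
Notation C2 R := (CC R * CC R)%type.

Section henon.
Variable R : realType.
Implicit Types (p : {poly R[i]}) (a : R[i]) (z : C2 R).

Definition henon p a z : C2 R := (z.2, p.[z.2] - a * z.1).

Definition henon_inv p a z : C2 R := ((p.[z.1] - z.2) / a, z.1).

Lemma henonK p a : a != 0 -> cancel (henon p a) (henon_inv p a).
Proof.
by move=> a0 [x y]; rewrite /henon /henon_inv /= subKr mulrC mulKf.
Qed.

Lemma henon_invK p a : a != 0 -> cancel (henon_inv p a) (henon p a).
Proof.
move=> a0 [x y]; rewrite /henon /henon_inv /= mulrC divfK //.
by rewrite subKr.
Qed.

Variable m : nat.
Implicit Types (ps : 'I_m -> {poly R[i]}) (cs : 'I_m -> R[i]).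

(* [enum 'I_m] lists the indices in increasing order, so index 0 acts first. *)
Definition henon_comp ps cs z : C2 R :=
  foldl (fun w j => henon (ps j) (cs j) w) z (enum 'I_m).

Definition henon_comp_inv ps cs z : C2 R :=
  foldr (fun j w => henon_inv (ps j) (cs j) w) z (enum 'I_m).

Lemma henon_compK ps cs : (forall j, cs j != 0) ->
  cancel (henon_comp ps cs) (henon_comp_inv ps cs).
Proof.
move=> cs0; rewrite /henon_comp /henon_comp_inv.
by elim: (enum _) => [//|j s IH] z /=; rewrite IH henonK.
Qed.

Lemma henon_comp_invK ps cs : (forall j, cs j != 0) ->
  cancel (henon_comp_inv ps cs) (henon_comp ps cs).
Proof.
move=> cs0; rewrite /henon_comp /henon_comp_inv.
by elim: (enum _) => [//|j s IH] z /=; rewrite henon_invK.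
Qed.

End henon.

Section fibred.
Variables (R : realType) (m : nat) (T : Type).
Variables (sigma sigmaV : T -> T).
Variables (p : 'I_m -> T -> {poly R[i]}) (a : 'I_m -> T -> CC R).

Definition fibred_henon (q : T * C2 R) : T * C2 R :=
  (sigma q.1, henon_comp (p ^~ q.1) (a ^~ q.1) q.2).

Definition fibred_henon_inv (q : T * C2 R) : T * C2 R :=
  (sigmaV q.1, henon_comp_inv (p ^~ (sigmaV q.1)) (a ^~ (sigmaV q.1)) q.2).

Hypothesis a0 : forall j l, a j l != 0.

Lemma fibred_henonK : cancel sigma sigmaV -> cancel fibred_henon fibred_henon_inv.
Proof.
by move=> sK [l z]; rewrite /fibred_henon /fibred_henon_inv /= sK henon_compK // => j; exact: a0.
Qed.

Lemma fibred_henon_invK : cancel sigmaV sigma -> cancel fibred_henon_inv fibred_henon.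
Proof.
by move=> sK [l z]; rewrite /fibred_henon /fibred_henon_inv /= henon_comp_invK ?sK.
Qed.

End fibred.

Section green.
Variables (R : realType) (k : nat) (M : set 'rV[CC R]_k).

Definition norm_CkC2 (q : M * C2 R) : R :=
  Num.sqrt (\sum_(i < k) (ComplexField.Normc.normc (set_val q.1 0 i)) ^+ 2
            + (ComplexField.Normc.normc q.2.1) ^+ 2 + (ComplexField.Normc.normc q.2.2) ^+ 2).

(* As [ln x = 0] for [x <= 0], this is also correct at [x = 0]. *)
Definition logplus (x : R) : R := Num.max (ln x) 0.

Definition green_seq (d : nat) (F : M * C2 R -> M * C2 R) (n : nat)
    (q : M * C2 R) : R :=
  (d%:R ^+ n)^-1 * logplus (norm_CkC2 (iter n F q)).

Definition bounded_orbits (F : M * C2 R -> M * C2 R) : set (M * C2 R) :=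
  [set q | exists B : R, forall n, norm_CkC2 (iter n F q) <= B].

End green.

Section psh.
Variable R : realType.

Definition upper_semicontinuous (V : topologicalType) (u : V -> \bar R) :=
  lower_semicontinuous (fun z => (- u z)%E).

Definition circle_mean (V : normedModType R[i]) (u : V -> \bar R) (z w : V) :=
  (((2 * pi)^-1)%:E *
    \int[lebesgue_measure]_(t in `[0%R, (2 * pi)%R])
      u (z + (cos t +i* sin t)%C *: w)%R)%E.

(* The function [u] is upper semicontinuous with values in [-oo, +oo[ and
   satisfies the sub-mean value inequality on every circle of every complex
   line; this is plurisubharmonicity on the whole space [V]. *)
Definition plurisubharmonic (V : normedModType R[i]) (u : V -> \bar R) :=
  [/\ forall z, (u z < +oo)%E,
      upper_semicontinuous u &
      forall z w, (u z <= circle_mean u z w)%E].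

(* The data depend only continuously on the parameter and the compact set [M]
   carries no complex structure, so that plurisubharmonicity on [M x C^2] is
   plurisubharmonicity on each fibre [{l} x C^2]. *)
Definition fibre_psh (T : Type) (G : T * C2 R -> R) :=
  forall l, plurisubharmonic (fun z : C2 R => (G (l, z))%:E).

End psh.

(* Main.v *)
Require Import Defs.
From HB Require Import structures.
From mathcomp Require Import all_boot all_order all_algebra.
From mathcomp Require Import all_classical all_reals all_analysis.
From mathcomp Require Import complex.
From mathcomp Require Import ring lra.

Set Implicit Arguments.
Unset Strict Implicit.
Unset Printing Implicit Defensive.

Import Order.TTheory GRing.Theory Num.Theory.
Import numFieldNormedType.Exports.

Local Open Scope classical_set_scope.
Local Open Scope ring_scope.

(** Write [N z] for the maximum norm of [z] in the plane, and [l z] for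
    [log^+ (N z)].  For large [r] the union of the bidisk [{N <= r}] and the
    sector [{|y| >= max (|x|, r)}], called trapped, is forward invariant under
    every Henon step [(x, y) |-> (y, q y - b x)] of degree [d], because a point
    of the bidisk either stays in the bidisk or lands in the sector.  On this
    set there is a constant [C] with
      [d (l z - C) <= l (h z) - C]  and  [l (h z) + C <= d (l z + C)],
    two inequalities that are stable under composition.  Compactness of the
    parameter space makes [C] uniform, so for the fibred map [F] of total
    degree [D] the sequences [D^-n (l o F^n - C)] and [D^-n (l o F^n + C)] are
    monotone in opposite directions.  Hence [D^-n l o F^n] converges with error
    at most [D^-n C] on the trapped set, and every compact set is trapped for
    [r] large ([green_rate_cvg]).  The full norm on [C^k x C^2] differs from
    [N] by a bounded factor once both are bounded below by 1, which does not
    change the limit.  Continuity and the functional equation follow.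

    In the sector the quantity [t = kappa |y|], where [2 kappa] is a lower
    bound of the leading coefficients, satisfies [t (h z) >= t ^ d]; so an
    orbit entering the sector far out has positive Green function, while an
    orbit that never enters it stays in the bidisk ([green_eq0P]).

    On a complex line [l o F^n] is the maximum of [log^+ |X|] and [log^+ |Y|]
    for two polynomials [X], [Y] in one variable.  The sub-mean value inequality
    for [log^+ |f|], with [f] a polynomial, is proved with Riemann sums over
    the [N]-th roots of unity: the product of [|f|] over these roots factors
    through [|a^N - 1|], with [a] ranging over the roots of [f], and is at
    least a constant times [|f 0|^N] provided that no [a] lies on the unit
    circle, which a small dilation of the variable ensures
    ([submean_nodes_logplus]).  Uniform approximation carries the inequality
    over to the Green function ([green_submean]).

    The inverse map is conjugate, by exchanging the two coordinates, to a map of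
    the same kind: [((p x - y) / a, x)] becomes [(y, (p y - x) / a)].  This is
    why the Henon steps below are allowed leading coefficients other than 1. *)

Local Notation normc := ComplexField.Normc.normc.

(** * The modulus of a complex number *)

Section modulus.
Variable R : rcfType.
Implicit Types x y : R[i].

Lemma normrE x : `|x| = (normc x)%:C%C.
Proof. by case: x => a b; rewrite normc_def. Qed.

Lemma normc_ge0 x : 0 <= normc x.
Proof. by case: x => a b; exact: sqrtr_ge0. Qed.

Lemma normc1 : normc (1 : R[i]) = 1.
Proof. exact: ComplexField.Normc.normc1. Qed.

Lemma normc0 : normc (0 : R[i]) = 0.
Proof. exact: ComplexField.Normc.normc0. Qed.

Lemma normcM x y : normc (x * y) = normc x * normc y.
Proof. exact: ComplexField.Normc.normcM. Qed.

Lemma normc_eq0 x : (normc x == 0) = (x == 0).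
Proof.
apply/eqP/eqP => [|->]; last exact: normc0.
exact: ComplexField.Normc.eq0_normc.
Qed.

Lemma normc_gt0 x : (0 < normc x) = (x != 0).
Proof. by rewrite lt0r normc_ge0 andbT normc_eq0. Qed.

Lemma normcX x n : normc (x ^+ n) = normc x ^+ n.
Proof. by elim: n => [|n IH]; rewrite ?normc1 // !exprS normcM IH. Qed.

Lemma normc_prod (I : Type) (r : seq I) (F : I -> R[i]) :
  normc (\prod_(i <- r) F i) = \prod_(i <- r) normc (F i).
Proof. exact: (big_morph _ normcM normc1). Qed.

Lemma normcV x : normc x^-1 = (normc x)^-1.
Proof. exact: ComplexField.Normc.normcV. Qed.

Lemma normcD_le x y : normc (x + y) <= normc x + normc y.
Proof. exact: le_normcD. Qed.

Lemma normc_opp x : normc (- x) = normc x.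
Proof. exact: (@normcN R). Qed.

Lemma normcB_le x y : normc (x - y) <= normc x + normc y.
Proof. by rewrite -(normc_opp y) normcD_le. Qed.

Lemma normc_distC x y : normc (x - y) = normc (y - x).
Proof. by rewrite -normc_opp opprB. Qed.

Lemma normcB_ge x y : normc x - normc y <= normc (x - y).
Proof. by rewrite lerBlDr -{1}(subrK y x) normcD_le. Qed.

Lemma normc_sum_le (I : Type) (r : seq I) (F : I -> R[i]) :
  normc (\sum_(i <- r) F i) <= \sum_(i <- r) normc (F i).
Proof.
elim/big_rec2: _ => [|i y1 y2 _ IH]; first by rewrite normc0.
by rewrite (le_trans (normcD_le _ _)) // lerD2l.
Qed.

Lemma normc_real (r : R) : 0 <= r -> normc (r%:C%C) = r.
Proof. by move=> r0; rewrite /= expr0n /= addr0 sqrtr_sqr ger0_norm. Qed.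

End modulus.

(** * The function log^+ *)

Section logplus.
Variable R : realType.
Implicit Types x y : R.

(** Truncating inside the logarithm turns [logplus] into the logarithm of a
    positive number, to which the multiplicative laws of [ln] apply. *)
Lemma logplusE x : logplus x = ln (Num.max 1 x).
Proof.
rewrite /logplus; have [x1|x1] := leP x 1.
  by rewrite ln1; apply: max_r; exact: ln_le0.
by apply: max_l; apply: ln_ge0; exact: ltW.
Qed.

Lemma logplus_ge0 x : 0 <= logplus x.
Proof. by rewrite /logplus le_max lexx orbT. Qed.

Lemma ln_le_logplus x : ln x <= logplus x.
Proof. by rewrite /logplus le_max lexx. Qed.

Lemma max1_gt0 x : 0 < Num.max 1 x.
Proof. by rewrite lt_max ltr01. Qed.

Lemma ler_logplus x y : x <= y -> logplus x <= logplus y.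
Proof.
move=> xy; rewrite !logplusE ler_ln ?posrE ?max1_gt0 //.
by rewrite ge_max !le_max lexx xy orbT.
Qed.

Lemma logplus_max x y :
  logplus (Num.max x y) = Num.max (logplus x) (logplus y).
Proof.
by have [xy|/ltW yx] := leP x y; [rewrite max_r|rewrite max_l] => //; exact: ler_logplus.
Qed.

Lemma logplus_lip x y : logplus x <= logplus y + `|x - y|.
Proof.
rewrite !logplusE; set a := Num.max 1 x; set b := Num.max 1 y.
have b1 : 1 <= b by rewrite le_max lexx.
have b0 : 0 < b by exact: lt_le_trans b1.
have a0 : 0 < a by exact: max1_gt0.
have ab : a - b <= `|x - y|.
  rewrite lerBlDr ge_max; apply/andP; split.
    by rewrite (le_trans b1) // lerDr.
  by rewrite -lerBlDr (le_trans _ (ler_norm _)) // lerB // le_max lexx orbT.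
have [leab|ltba] := leP a b.
  by rewrite (le_trans (y := ln b)) ?ler_ln ?posrE ?lerDl.
have : ln (1 + (a / b - 1)) <= a / b - 1.
  by apply: le_ln1Dx; rewrite ltrBrDr addNr divr_gt0.
rewrite addrC subrK ln_div ?posrE // lerBlDl => /le_trans; apply.
rewrite lerD2l; apply: le_trans ab.
have -> : a / b - 1 = (a - b) / b by rewrite mulrBl divff ?gt_eqF.
by rewrite ler_pdivrMr // ler_peMr // subr_ge0 ltW.
Qed.

Lemma logplus_dist x y : `|logplus x - logplus y| <= `|x - y|.
Proof.
have := logplus_lip x y; have := logplus_lip y x.
by rewrite (distrC y) ler_norml; lra.
Qed.

Lemma continuous_logplus : continuous (@logplus R : R^o -> R^o).
Proof.
move=> x; apply/cvgrPdist_le => /= e e0; near=> y.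
apply: le_trans (logplus_dist _ _) _; near: y.
by apply: cvgr_dist_le.
Unshelve. all: by end_near. Qed.

End logplus.

(** * Roots of unity on the circle *)

Section circle.
Variable R : realType.

Definition cis (t : R) : R[i] := (cos t +i* sin t)%C.

Lemma cis0 : cis 0 = 1.
Proof. by rewrite /cis cos0 sin0. Qed.

Lemma cisD s t : cis (s + t) = cis s * cis t.
Proof.
rewrite /cis cosD sinD; apply/eqP.
by rewrite eq_complex /= eqxx [X in _ == X]addrC eqxx.
Qed.

Lemma cis_nat t n : cis (t *+ n) = cis t ^+ n.
Proof. by elim: n => [|n IH]; rewrite ?cis0 // mulrS cisD IH exprS. Qed.

Lemma normc_cis t : normc (cis t) = 1.
Proof. by rewrite /cis /= cos2Dsin2 sqrtr1. Qed.

(** The arguments of the [N]-th roots of unity. *)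
Definition node N k : R := 2 * pi * k%:R / N%:R.

Lemma cis_node N k : cis (node N k) = cis (node N 1) ^+ k.
Proof. by rewrite -cis_nat /node -mulrnAl mulr1 mulr_natr. Qed.

Lemma prim_root_node N : (0 < N)%N -> N.-primitive_root (cis (node N 1)).
Proof.
move=> N0; have N0' : (0 : R) < N%:R by rewrite ltr0n.
rewrite /primitive_root_of_unity N0 /=; apply/forallP => i.
rewrite unity_rootE -cis_node; apply/eqP.
have iN : (i.+1 <= N)%N := ltn_ord i.
have [->|neN] := eqVneq i.+1 N.
  by rewrite /node mulfK ?(gt_eqF N0') // mulrC mulr_natr /cis cos2pi sin2pi !eqxx.
have ltN : (i.+1 < N)%N by rewrite ltn_neqAle neN.
apply/negbTE; apply/eqP => -[+ _].
have -> : node N i.+1 = (pi * i.+1%:R / N%:R) *+ 2 by rewrite /node mulr2n; ring.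
rewrite cos_mulr2n => c1.
have : 0 < sin (pi * i.+1%:R / N%:R : R).
  apply: sin_gt0_pi; rewrite divr_gt0 ?mulr_gt0 ?pi_gt0 ?ltr0n //=.
  by rewrite ltr_pdivrMr // ltr_pM2l ?pi_gt0 // ltr_nat.
by move/(exprn_gt0 2); rewrite sin2cos2; move: c1; rewrite mulr2n; lra.
Qed.

Lemma prod_nodes N (a : R[i]) : (0 < N)%N ->
  \prod_(k < N) (cis (node N k) - a) = (-1) ^+ N * (a ^+ N - 1).
Proof.
move=> /prim_root_node/factor_Xn_sub_1 prodE.
have -> : a ^+ N - 1 = ('X^N - 1 : {poly R[i]}).[a].
  by rewrite hornerD hornerXn hornerN hornerC.
rewrite -prodE horner_prod.
rewrite big_mkord -[X in (-1) ^+ X](card_ord N) -prodrN.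
by apply: eq_bigr => k _; rewrite hornerXsubC opprB cis_node.
Qed.

End circle.
(** * Jensen's inequality over the roots of unity *)

Section submean_poly.
Variable R : realType.
Implicit Types (a : R[i]) (f : {poly R[i]}).

(** Inside the unit disk [|a ^+ N - 1|] stays away from 0 and [|a| ^+ N] is at
    most 1; outside it, [|a| ^+ N] dominates 1 geometrically. *)
Lemma normc_unity_dist_ge a : normc a != 1 ->
  exists2 D, 0 < D & forall N, (0 < N)%N -> D * normc a ^+ N <= normc (a ^+ N - 1).
Proof.
have n0 := normc_ge0 a; rewrite neq_lt => /orP[lt1|gt1].
- exists (1 - normc a); first by rewrite subr_gt0.
  move=> N N0; apply: le_trans (_ : 1 - normc a <= _).
    by apply: ler_piMr; rewrite ?subr_ge0 ?exprn_ile1 // ltW.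
  rewrite normc_distC; apply: le_trans (normcB_ge _ _).
  by rewrite normc1 normcX lerB // -[leRHS]expr1 ler_wiXn2l // ltW.
- have a0 : 0 < normc a by exact: lt_trans gt1.
  exists (1 - (normc a)^-1); first by rewrite subr_gt0 invf_lt1.
  case=> // N _; apply: le_trans (normcB_ge _ _).
  rewrite normc1 normcX mulrBl mul1r exprS mulKf ?gt_eqF //.
  by rewrite lerB // exprn_ege1 // ltW.
Qed.

Lemma prod_roots_nodes_ge (r : seq R[i]) : (forall a, a \in r -> normc a != 1) ->
  exists2 D, 0 < D & forall N, (0 < N)%N ->
    D * (\prod_(a <- r) normc a) ^+ N <=
    \prod_(k < N) \prod_(a <- r) normc (cis (node R N k) - a).
Proof.
elim: r => [|a r IH] hr.
  exists 1 => // N _; rewrite big_nil expr1n mulr1.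
  by rewrite big1 // => k _; rewrite big_nil.
have [|D D0 hD] := IH; first by move=> b br; apply: hr; rewrite inE br orbT.
have [E E0 hE] := normc_unity_dist_ge (hr a (mem_head _ _)).
exists (E * D) => [|N N0]; first exact: mulr_gt0.
under [leRHS]eq_bigr do rewrite big_cons.
rewrite big_split big_cons exprMn mulrACA.
rewrite ler_pM ?mulr_ge0 ?exprn_ge0 ?normc_ge0 ?(ltW E0) ?(ltW D0) //=.
- by apply: prodr_ge0 => b _; exact: normc_ge0.
- rewrite -normc_prod prod_nodes // normcM normcX normc_opp normc1 expr1n mul1r.
  exact: hE.
- exact: hD.
Qed.

(** Jensen's inequality in multiplicative form: up to the leading coefficient,
    the product of [|f|] over the [N]-th roots of unity is a product of factors
    [|a ^+ N - 1|], one for each root [a], and off the unit circle each of them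
    is at least a constant times [|a| ^+ N]. *)
Lemma prod_poly_nodes_ge f : (forall a, root f a -> normc a != 1) ->
  exists2 D, 0 < D & forall N, (0 < N)%N ->
    D * normc f.[0] ^+ N <= \prod_(k < N) normc f.[cis (node R N k)].
Proof.
have [r fE] := closed_field_poly_normal f.
have [f0|f0] := eqVneq f 0.
  move=> _; exists 1 => // N N0; rewrite f0 horner0 normc0 expr0n gtn_eqF // mulr0.
  by apply: prodr_ge0 => k _; exact: normc_ge0.
have fz z : normc f.[z] = normc (lead_coef f) * \prod_(a <- r) normc (z - a).
  rewrite {1}fE hornerZ normcM horner_prod normc_prod.
  by congr (_ * _); apply: eq_bigr => a _; rewrite hornerXsubC.
move=> hf; have [|D D0 hD] := @prod_roots_nodes_ge r.
  move=> a ar; apply: hf; rewrite fE rootZ ?lead_coef_eq0 //.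
  by rewrite root_prod_XsubC.
exists D => // N N0; rewrite fz.
under [leRHS]eq_bigr do rewrite fz.
rewrite big_split /= prodr_const card_ord exprMn mulrCA.
rewrite ler_wpM2l ?exprn_ge0 ?normc_ge0 //.
under [X in D * X ^+ _]eq_bigr do rewrite sub0r normc_opp.
exact: hD.
Qed.

Lemma ln_prod (I : Type) (r : seq I) (F : I -> R) : (forall i, 0 < F i) ->
  ln (\prod_(i <- r) F i) = \sum_(i <- r) ln (F i).
Proof.
move=> F0; elim: r => [|i r IH]; first by rewrite !big_nil ln1.
by rewrite !big_cons lnM ?posrE ?prodr_gt0 // IH.
Qed.

Lemma sum_logplus_nodes_ge f : (forall a, root f a -> normc a != 1) ->
  exists C, forall N, (0 < N)%N ->
    N%:R * logplus (normc f.[0]) - C <=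
    \sum_(k < N) logplus (normc f.[cis (node R N k)]).
Proof.
move=> /prod_poly_nodes_ge[D D0 hD].
have [f1|f1] := leP (normc f.[0]) 1.
  exists 0 => N N0; rewrite subr0.
  rewrite {1}logplusE max_l // ln1 mulr0.
  by apply: sumr_ge0 => k _; exact: logplus_ge0.
have f0 : 0 < normc f.[0] by exact: lt_trans f1.
exists (- ln D) => N N0; rewrite opprK.
rewrite {1}logplusE (max_r (ltW f1)) addrC mulr_natl -lnXn // -lnM ?posrE ?exprn_gt0 //.
have prod_gt : 0 < \prod_(k < N) normc f.[cis (node R N k)].
  by apply: lt_le_trans (hD N N0); rewrite mulr_gt0 ?exprn_gt0.
apply: (@le_trans _ _ (ln (\prod_(k < N) normc f.[cis (node R N k)]))).
  by rewrite ler_ln ?posrE ?hD // mulr_gt0 ?exprn_gt0.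
apply: (@le_trans _ _ (ln (\prod_(k < N) Num.max 1 (normc f.[cis (node R N k)])))).
  rewrite ler_ln ?posrE //; last by apply: prodr_gt0 => k _; exact: max1_gt0.
  apply: ler_prod => k _; rewrite normc_ge0 /=.
  by rewrite le_max lexx orbT.
rewrite ln_prod => [|k]; last exact: max1_gt0.
by apply: ler_sum => k _; rewrite logplusE.
Qed.

End submean_poly.
(** * The discrete sub-mean value inequality for log^+ of a polynomial *)

Section submean_logplus.
Variable R : realType.
Implicit Types (f : {poly R[i]}).

Lemma exists_itv_notin (s : seq R) (a b : R) : a < b ->
  exists2 r, a < r < b & r \notin s.
Proof.
elim: s a b => [|x s IH] a b ab.
  by exists ((a + b) / 2) => //; rewrite !midf_lt.
have [xm|mx] := leP x ((a + b) / 2).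
- have [r /andP[mr rb] rs] := IH ((a + b) / 2) b (midf_lt ab).2.
  exists r; first by rewrite rb andbT (lt_trans _ mr) // midf_lt.
  by rewrite inE negb_or rs andbT gt_eqF // (le_lt_trans xm).
- have [r /andP[ar rm] rs] := IH a ((a + b) / 2) (midf_lt ab).1.
  exists r; first by rewrite ar (lt_trans rm) // midf_lt.
  by rewrite inE negb_or rs andbT lt_eqF // (lt_trans rm).
Qed.

Lemma bernoulli_le (r : R) n : 0 <= r <= 1 -> 1 - r ^+ n <= n%:R * (1 - r).
Proof.
move=> /andP[r0 r1]; elim: n => [|n IH]; first by rewrite subrr mul0r.
have -> : 1 - r ^+ n.+1 = (1 - r ^+ n) + r ^+ n * (1 - r) by rewrite exprSr; ring.
rewrite -natr1 mulrDl mul1r lerD // ler_piMl ?subr_ge0 //.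
exact: exprn_ile1.
Qed.

(** The roots of [f (r x)] are those of [f] divided by [r], so all but finitely
    many [r] slightly below 1 move them off the unit circle. *)
Lemma perturb_roots_off_circle f (e : R) : f != 0 -> 0 < e ->
  exists g, [/\ g.[0] = f.[0], (forall a, root g a -> normc a != 1) &
    forall t, normc (f.[cis t] - g.[cis t]) <= e].
Proof.
move=> f0 e0; have [s fE] := closed_field_poly_normal f.
pose C : R := \sum_(i < size f) normc f`_i * i%:R.
have C0 : 0 <= C by apply: sumr_ge0 => i _; rewrite mulr_ge0 ?normc_ge0.
have lt1 : Num.max 0 (1 - e / (C + 1)) < 1.
  by rewrite gt_max ltr01 /= ltrBlDr ltrDl divr_gt0 // ltr_wpDl.
have [r /andP[]] := exists_itv_notin (map (@ComplexField.Normc.normc R) s) lt1.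
rewrite gt_max => /andP[r0 re] r1 rs.
exists (f \Po (r%:C%C *: 'X)); split.
- by rewrite horner_comp hornerZ hornerX mulr0.
- move=> a; rewrite rootE horner_comp hornerZ hornerX -rootE {1}fE.
  rewrite rootZ ?lead_coef_eq0 // root_prod_XsubC => ras.
  apply: contra rs => /eqP a1; apply/mapP; exists (r%:C%C * a) => //.
  by rewrite normcM a1 mulr1 normc_real // ltW.
move=> t; rewrite horner_comp hornerZ hornerX !horner_coef -sumrB.
apply: le_trans (normc_sum_le _ _) _.
apply: (@le_trans _ _ (C * (1 - r))).
  rewrite mulr_suml; apply: ler_sum => i _.
  rewrite -mulrBr exprMn -{1}[_ ^+ i]mul1r -mulrBl !normcM normcX normc_cis expr1n mulr1.
  rewrite -mulrA ler_wpM2l ?normc_ge0 //.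
  have -> : 1 - r%:C%C ^+ i = (1 - r ^+ i)%:C%C :> R[i].
    by rewrite rmorphB rmorph1 rmorphXn.
  have r01 : 0 <= r <= 1 by rewrite !ltW.
  rewrite normc_real ?bernoulli_le // subr_ge0 exprn_ile1 // ltW //.
move: re; rewrite ltrBlDr -ltrBlDl ltr_pdivlMr ?ltr_wpDl // => re.
by apply: le_trans (ltW re); rewrite mulrC ler_wpM2l ?lerDl ?subr_ge0 ?ltW.
Qed.

Definition node_mean (v : R -> R) N := N%:R^-1 * \sum_(k < N) v (node R N k).

(** If [|f 0| > 1] the multiplicative inequality gives the bound up to an error
    [C / N], since [log^+] dominates [log]; if [|f 0| <= 1] the bound is trivial.
    Roots on the unit circle are removed by a perturbation, which [log^+]
    tolerates because it is 1-Lipschitz. *)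
Lemma submean_nodes_logplus f (e : R) : 0 < e ->
  exists N0, forall N, (N0 <= N)%N -> (0 < N)%N ->
    logplus (normc f.[0]) - e <= node_mean (fun t => logplus (normc f.[cis t])) N.
Proof.
move=> e0; have e20 : 0 < e / 2 by rewrite divr_gt0.
have [->|f0] := eqVneq f 0.
  exists 0%N => N _ N0; rewrite horner0 normc0 logplusE max_l // ln1 sub0r.
  apply: (@le_trans _ _ 0); first by rewrite oppr_le0 ltW.
  apply: mulr_ge0; first by rewrite invr_ge0.
  by apply: sumr_ge0 => k _; exact: logplus_ge0.
have [g [g0 groot gf]] := perturb_roots_off_circle f0 e20.
have [C hC] := sum_logplus_nodes_ge groot.
have [N0 hN0] : exists N0 : nat, C / (e / 2) < N0%:R.
  by exists (Num.truncn (C / (e / 2))).+1; exact: truncnS_gt.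
exists N0 => N N0N Npos; rewrite /node_mean.
have N0' : (0 : R) < N%:R by rewrite ltr0n.
rewrite ler_pdivlMl //.
have CN : C <= N%:R * (e / 2).
  rewrite -ler_pdivrMr //; apply/ltW/(lt_le_trans hN0).
  by rewrite ler_nat.
apply: (@le_trans _ _ (\sum_(k < N) (logplus (normc g.[cis (node R N k)]) - e / 2))).
  rewrite sumrB sumr_const card_ord -mulr_natl.
  by have := hC N Npos; rewrite g0; lra.
apply: ler_sum => k _; rewrite lerBlDr.
apply: le_trans (logplus_lip _ (normc f.[cis (node R N k)])) _.
rewrite lerD2l; apply: le_trans (gf (node R N k)).
rewrite ler_norml lerNl opprB normcB_ge /= normc_distC; exact: normcB_ge.
Qed.

End submean_logplus.
(** * Riemann sums of a continuous function *)

Section riemann.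
Variable R : realType.
Notation mu := (@lebesgue_measure R).

Lemma uniformly_continuous_segment (v : R -> R) (a b e : R) :
  continuous v -> 0 < e ->
  exists2 d, 0 < d & forall x y, a <= x <= b -> `|x - y| < d -> `|v x - v y| <= e.
Proof.
move=> cv e0; have e20 : 0 < e / 2 by rewrite divr_gt0.
have /compact_near_coveringP ncov := @segment_compact R a b.
(* Compactness is used as the exchange of a quantifier over the segment with
   the germ at [0+] in which the modulus [d] lives. *)
have := ncov R (0%R^'+) (fun d x => forall y, `|x - y| < d -> `|v x - v y| <= e).
move=> /(_ _ _)[].
  move=> x _.
  have /cvgrPdist_le/(_ _ e20) /nbhs_ballP[r /= r0 hr] := cv x.
  exists (ball x (r / 2), [set d | d < r / 2]) => /=.
    by split; [apply: nbhsx_ballx; rewrite divr_gt0|apply: nbhs_right_lt; rewrite divr_gt0].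
  move=> [x' d] /= [xx' dr] y x'y.
  have h1 := hr x'; have h2 := hr y.
  rewrite -[v x' - v y](subrKA (v x)) (le_trans (ler_normD _ _)) //.
  rewrite [leRHS](splitr e) lerD //.
    rewrite distrC; apply: h1; rewrite /ball /= in xx' *; move: xx'; lra.
  apply: h2; rewrite /ball /= in xx' *.
  rewrite -(subrKA x') (le_lt_trans (ler_normD _ _)) // (splitr r) ltrD //.
  by rewrite (lt_trans x'y).
move=> d /= d0 hd.
exists (d / 2); first by rewrite divr_gt0.
move=> x y xab xy; apply: (hd (d / 2)) => //=.
- by rewrite sub0r normrN gtr0_norm ?divr_gt0 // gtr_pMr // invf_lt1 // ltr1n.
- by rewrite divr_gt0.
Qed.

Lemma nodeS N k : node R N k.+1 - node R N k = 2 * pi / N%:R.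
Proof. by rewrite /node -mulrBl -mulrBr -[k.+1%:R]natr1 addrAC subrr add0r mulr1. Qed.

Lemma node_itv N k : (k <= N)%N -> (0 < N)%N -> 0 <= node R N k <= 2 * pi.
Proof.
move=> kN N0; have N0' : (0 : R) < N%:R by rewrite ltr0n.
have p0 : (0 : R) <= 2 * pi by rewrite mulr_ge0 // pi_ge0.
rewrite /node (divr_ge0 (mulr_ge0 p0 _)) //= ler_pdivrMr // ler_wpM2l //.
by rewrite ler_nat.
Qed.

(** The mean value theorem is applied to a primitive on each subinterval, so that
    the equality is exact. *)
Lemma integral_as_node_sum (v : R -> R) : continuous v ->
  forall N, (0 < N)%N -> exists2 xi : nat -> R,
    forall k, (k < N)%N -> node R N k <= xi k <= node R N k.+1 &
    \int[mu]_(t in `[0, 2 * pi]) v t = 2 * pi / N%:R * \sum_(k < N) v (xi k).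
Proof.
move=> cv N N0; have p0 : (0 : R) < 2 * pi by rewrite mulr_gt0 // pi_gt0.
have cvw (A : set R) : {within A, continuous v} by exact: continuous_subspaceT.
(* The primitive starts at -1 and is considered up to [2 pi + 1], so that it is
   differentiable at both ends of [[0, 2 pi]]. *)
pose u : R := 2 * pi + 1.
have iv : mu.-integrable `[-1, u] (EFin \o v).
  by apply: continuous_compact_integrable; [exact: segment_compact|exact: cvw].
pose F (x : R) := \int[mu]_(t in `[-1, x]) v t.
have dF (x : R) : x \in `[0, 2 * pi] -> derivable F x 1 /\ F^`()%classic x = v x.
  rewrite in_itv /= => /andP[x0 x2]; apply: (@continuous_FTC1_closed _ _ _ _ u) => //.
  - by rewrite /u; lra.
  - by rewrite (lt_le_trans _ x0).
  - exact: cv.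
have dFi : forall z : R, z \in `[0, 2 * pi] ->
    is_derive (z : R^o) 1 (F : R^o -> R^o) (v z).
  by move=> z /dF[d1 d2]; apply: DeriveDef; [exact: d1|rewrite -derive1E].
have nodein k : (k <= N)%N -> node R N k \in `[0, 2 * pi].
  by move=> kN; rewrite in_itv /= node_itv.
have hxi k : exists x, (k < N)%N -> node R N k <= x <= node R N k.+1 /\
    F (node R N k.+1) - F (node R N k) = v x * (node R N k.+1 - node R N k).
  have [kN|] := ltnP k N; last by exists 0.
  have sub x : x \in `[node R N k, node R N k.+1] -> x \in `[0, 2 * pi].
    have := nodein _ kN; have := nodein _ (ltnW kN); rewrite !in_itv /=; lra.
  have lenode : node R N k <= node R N k.+1.
    by rewrite -subr_ge0 nodeS divr_ge0 // ltW.
  have dnode : forall z, z \in `]node R N k, node R N k.+1[ ->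
      is_derive (z : R^o) 1 (F : R^o -> R^o) (v z).
    by move=> z zin; apply: dFi; apply: sub; apply: subset_itv_oo_cc zin.
  have cnode : {within `[node R N k, node R N k.+1], continuous F}.
    by apply: derivable_within_continuous => z /sub/dF[].
  have [y yin yE] := MVT_segment lenode dnode cnode.
  by exists y.
have [xi hxi'] := choice hxi.
exists xi => [k kN|]; first by have [] := hxi' k kN.
have -> : \int[mu]_(t in `[0, 2 * pi]) v t = F (2 * pi) - F 0.
  rewrite /F Rintegral_itvB.
  - rewrite Rintegral_itv_obnd_cbnd //.
    apply: (@integrableS _ _ _ mu `[-1, u]) iv => //.
    by apply: subset_itv; rewrite bnd_simp // /u; lra.
  - apply: (@integrableS _ _ _ mu `[-1, u]) iv => //.
    by apply: subset_itvl; rewrite bnd_simp /u; lra.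
  - by rewrite bnd_simp.
  - by rewrite bnd_simp ltW.
have -> : F (2 * pi) - F 0 = F (node R N N) - F (node R N 0).
  by rewrite /node mulr0 mul0r mulfK // gt_eqF // ltr0n.
rewrite -(telescope_sumr (fun k => F (node R N k)) (leq0n N)) big_mkord mulr_sumr.
by apply: eq_bigr => k _; have [_ ->] := hxi' k (ltn_ord k); rewrite nodeS mulrC.
Qed.

(** The integral is itself an average of values at points interlaced with the
    nodes, and uniform continuity compares these with the values at the
    nodes. *)
Lemma integral_ge_of_node_mean (v : R -> R) (c : R) : continuous v ->
  (forall e, 0 < e -> exists N0, forall N, (N0 <= N)%N -> (0 < N)%N ->
     c - e <= node_mean v N) ->
  2 * pi * c <= \int[mu]_(t in `[0, 2 * pi]) v t.
Proof.
move=> cv hv; have p0 : (0 : R) < 2 * pi by rewrite mulr_gt0 // pi_gt0.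
apply/ler_addgt0Pr => e e0; pose e' := e / (2 * pi) / 2.
have e'0 : 0 < e' by rewrite !divr_gt0.
have [d d0 hd] := uniformly_continuous_segment 0 (2 * pi) cv e'0.
have [N0 hN0] := hv _ e'0.
pose N := (N0 + (Num.truncn (2 * pi / d)).+1)%N.
have Npos : (0 < N)%N by rewrite /N addnS.
have N0' : (0 : R) < N%:R by rewrite ltr0n.
have Nd : 2 * pi / N%:R < d.
  rewrite ltr_pdivrMr // [ltRHS]mulrC -ltr_pdivrMr //.
  by apply: lt_le_trans (truncnS_gt _) _; rewrite ler_nat leq_addl.
have [xi hxi ->] := integral_as_node_sum cv Npos.
have := hN0 N (leq_addr _ _) Npos; rewrite /node_mean.
set S := \sum_(k < N) _; set T := \sum_(k < N) _ => cS.
have ST : N%:R^-1 * S <= N%:R^-1 * T + e'.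
  rewrite -(mulKf (lt0r_neq0 N0') e') -mulrDr ler_wpM2l ?invr_ge0 //.
  rewrite mulr_natl -[X in e' *+ X](card_ord N) -sumr_const -big_split /=.
  apply: ler_sum => k _; rewrite -lerBlDl.
  have kN := ltn_ord k; have /andP[x1 x2] := hxi k kN.
  apply: le_trans (ler_norm _) _; apply: hd.
    by rewrite node_itv // ltnW.
  rewrite distrC ger0_norm ?subr_ge0 //.
  by apply: le_lt_trans Nd; rewrite -(nodeS N k) lerB.
have -> : 2 * pi / N%:R * T = 2 * pi * (N%:R^-1 * T) by rewrite mulrA.
have -> : e = 2 * pi * (e' + e') by rewrite -splitr mulrC divfK // gt_eqF.
rewrite -mulrDr ler_wpM2l ?(ltW p0) //; move: cS ST; lra.
Qed.

End riemann.
(** * Growth of a single Henon step *)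

Section growth.
Variable R : realType.
Implicit Types (z : C2 R) (q : {poly R[i]}) (b : R[i]).

Definition maxnorm z : R := Num.max (normc z.1) (normc z.2).

Definition lognorm z : R := logplus (maxnorm z).

Lemma lognorm_ge0 z : 0 <= lognorm z.
Proof. exact: logplus_ge0. Qed.

Lemma maxnorm1 z : normc z.1 <= maxnorm z.
Proof. by rewrite le_max lexx. Qed.

Lemma maxnorm2 z : normc z.2 <= maxnorm z.
Proof. by rewrite le_max lexx orbT. Qed.

(** The leading coefficient is bounded below by [2 kappa], not [kappa]: half of
    the leading term absorbs the lower order terms on the escape region. *)
Definition henon_bound (A kappa : R) (d : nat) q b :=
  [/\ (2 <= d)%N, (size q <= d.+1)%N, 2 * kappa <= normc q`_d &
      \sum_(i < d.+1) normc q`_i + normc b <= A].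

(** For large [r], forward orbits that enter this region tend to infinity. *)
Definition escape_region (r : R) : set (C2 R) :=
  [set z | r <= normc z.2 /\ normc z.1 <= normc z.2].

Definition trap_region (r : R) : set (C2 R) :=
  [set z | maxnorm z <= r \/ escape_region r z].

Variables (A kappa : R).
Hypotheses (A1 : 1 <= A) (k0 : 0 < kappa) (k1 : kappa <= 1).

(** The first bound makes the leading term dominate, the second one makes
    [kappa |y|] at least 2 on the escape region. *)
Definition radius_ok (r : R) := A / kappa <= r /\ 2 / kappa <= r.

Lemma radius_ge1 r : radius_ok r -> 1 <= r.
Proof.
move=> [Ar _]; apply: le_trans Ar.
by rewrite ler_pdivlMr // mul1r (le_trans k1).
Qed.

Lemma henon_upper d q b z : henon_bound A kappa d q b ->
  normc (henon q b z).2 <= A * Num.max 1 (maxnorm z) ^+ d.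
Proof.
move=> [d2 sq _ qA]; rewrite /henon /=; set N := Num.max 1 _.
have N1 : 1 <= N by rewrite le_max lexx.
have N0 : 0 <= N by exact: le_trans N1.
apply: le_trans (normcB_le _ _) _; rewrite (horner_coef_wide _ sq).
apply: (@le_trans _ _ ((\sum_(i < d.+1) normc q`_i + normc b) * N ^+ d)); last first.
  by rewrite ler_wpM2r ?exprn_ge0.
rewrite mulrDl mulr_suml lerD //.
  apply: le_trans (normc_sum_le _ _) _; apply: ler_sum => i _.
  rewrite normcM normcX ler_wpM2l ?normc_ge0 //.
  apply: (@le_trans _ _ (N ^+ i)).
    by rewrite lerXn2r ?nnegrE ?normc_ge0 // /N le_max maxnorm2 orbT.
  by rewrite ler_weXn2l // -ltnS ltn_ord.
rewrite normcM ler_wpM2l ?normc_ge0 //.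
apply: (@le_trans _ _ N); first by rewrite /N le_max maxnorm1 orbT.
by rewrite -{1}[N]expr1 ler_weXn2l // ltnW.
Qed.

Lemma henon_lower r d q b z : radius_ok r -> henon_bound A kappa d q b ->
  escape_region r z -> kappa * normc z.2 ^+ d <= normc (henon q b z).2.
Proof.
move=> rok [d2 sq qk qA] [rz xy]; rewrite /henon /=.
set y := normc z.2 in rz xy *.
have y1 : 1 <= y by exact: le_trans (radius_ge1 rok) _.
have y0 : 0 < y by exact: lt_le_trans y1.
set X := q.[z.2] - b * z.1; pose T := \sum_(i < d) q`_i * z.2 ^+ i.
have leadE : q`_d * z.2 ^+ d = X + (b * z.1 - T).
  rewrite /X (horner_coef_wide _ sq) big_ord_recr /= -/T; ring.
have lead_le : 2 * kappa * y ^+ d <= normc X + (normc (b * z.1) + normc T).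
  rewrite (@le_trans _ _ (normc (q`_d * z.2 ^+ d))) //.
    by rewrite normcM normcX ler_wpM2r // exprn_ge0 // ltW.
  by rewrite leadE (le_trans (normcD_le _ _)) // lerD2l normcB_le.
have dE : y ^+ d = y * y ^+ d.-1 by rewrite -exprS prednK // ltnW.
have low_le : normc (b * z.1) + normc T <= A * y ^+ d.-1.
  apply: (@le_trans _ _ ((\sum_(i < d) normc q`_i + normc b) * y ^+ d.-1)).
    rewrite addrC mulrDl lerD //.
      rewrite mulr_suml; apply: le_trans (normc_sum_le _ _) _.
      apply: ler_sum => i _; rewrite normcM normcX ler_wpM2l ?normc_ge0 //.
      by rewrite ler_weXn2l // -ltnS prednK ?ltn_ord // ltnW.
    rewrite normcM ler_wpM2l ?normc_ge0 // (le_trans xy) // -{1}[y]expr1.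
    by rewrite ler_weXn2l // -ltnS prednK // ltnW.
  rewrite ler_wpM2r ?exprn_ge0 ?(ltW y0) // (le_trans _ qA) // lerD2r.
  by rewrite big_ord_recr /= lerDl normc_ge0.
have Ay : A * y ^+ d.-1 <= kappa * y ^+ d.
  rewrite dE mulrA ler_wpM2r ?exprn_ge0 ?(ltW y0) //.
  by rewrite mulrC -ler_pdivrMr // (le_trans _ rz) //; case: rok.
by move: lead_le; rewrite -mulrA mulr_natl mulr2n; move: (le_trans low_le Ay); lra.
Qed.

(** The factor [kappa] is absorbed by working with [kappa |y|]: as [kappa <= 1]
    and [d >= 2], one has [kappa * (kappa |y|^d) >= (kappa |y|)^d].  In this
    form the estimate iterates without error terms. *)
Lemma henon_escape r d q b z : radius_ok r -> henon_bound A kappa d q b ->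
  escape_region r z ->
  escape_region r (henon q b z) /\
  (kappa * normc z.2) ^+ d <= kappa * normc (henon q b z).2.
Proof.
move=> rok hb zr; have low := henon_lower rok hb zr.
have [d2 _ _ _] := hb; have [rz xy] := zr.
set y1 := normc (henon q b z).2 in low *; set y := normc z.2 in low rz xy *.
have y1' : 1 <= y by exact: le_trans (radius_ge1 rok) _.
have y0 : 0 < y by exact: lt_le_trans y1'.
have ky : 1 <= kappa * y.
  rewrite mulrC -ler_pdivrMr // (le_trans _ rz) // (le_trans _ rok.2) //.
  by rewrite ler_wpM2r ?invr_ge0 ?(ltW k0) // ler1n.
have dE : (kappa * y) ^+ d = kappa ^+ d.-2 * (kappa * (kappa * y ^+ d)).
  rewrite exprMn -{1}(subnK d2) exprD subn2 expr2; ring.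
have kd : (kappa * y) ^+ d <= kappa * (kappa * y ^+ d).
  rewrite dE ler_piMl ?mulr_ge0 ?exprn_ge0 ?(ltW k0) ?(ltW y0) //.
  by rewrite exprn_ile1 // ltW.
have kd1 : (kappa * y) ^+ d <= kappa * y1.
  by rewrite (le_trans kd) // ler_wpM2l // ltW.
have yy1 : y <= y1.
  rewrite -(ler_pM2l k0) (le_trans _ kd1) // -{1}[kappa * y]expr1.
  by rewrite ler_weXn2l // ltnW.
by split=> //; split=> //=; exact: le_trans yy1.
Qed.

(** The first coordinate of the image is the old [y], so a point of the bidisk
    whose image leaves the bidisk has an image with dominating [y]. *)
Lemma trap_henon r d q b z : radius_ok r -> henon_bound A kappa d q b ->
  trap_region r z -> trap_region r (henon q b z).
Proof.
move=> rok hb [zr|zr]; last by right; have [] := henon_escape rok hb zr.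
have yr : normc z.2 <= r := le_trans (maxnorm2 z) zr.
have [y1r|ry1] := leP (normc (henon q b z).2) r.
  by left; rewrite /maxnorm ge_max y1r yr.
by right; split; [exact: ltW|apply: ltW; exact: le_lt_trans ry1].
Qed.

(** [ln A] pays for the upper bound, [- ln kappa] for the lower bound on the
    escape region, and [2 ln r] for the lower bound on the bidisk, where the
    logarithm of the norm may drop from [ln r] to 0. *)
Definition log_error (r : R) : R := ln A - ln kappa + 2 * ln r.

Lemma log_error_terms r : radius_ok r ->
  [/\ 0 <= ln A, 0 <= - ln kappa & 0 <= ln r].
Proof.
by move=> rok; split; rewrite ?oppr_ge0 ?ln_ge0 ?ln_le0 ?(radius_ge1 rok).
Qed.

Lemma lognorm_henon_upper r d q b z : radius_ok r -> henon_bound A kappa d q b ->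
  lognorm (henon q b z) + log_error r <= d%:R * (lognorm z + log_error r).
Proof.
move=> rok hb; have [A0 kk r0] := log_error_terms rok.
have [d2 _ _ _] := hb.
have N1 : 1 <= Num.max 1 (maxnorm z) by rewrite le_max lexx.
have Apos : 0 < A by exact: lt_le_trans A1.
have Nle : Num.max 1 (maxnorm (henon q b z)) <= A * Num.max 1 (maxnorm z) ^+ d.
  have N1d : 1 <= Num.max 1 (maxnorm z) ^+ d by exact: exprn_ege1.
  rewrite !ge_max (henon_upper _ hb) andbT; apply/andP; split.
    by rewrite -[leLHS]mulr1 ler_pM.
  apply: (@le_trans _ _ (1 * Num.max 1 (maxnorm z) ^+ 1)).
    by rewrite mul1r expr1 le_max maxnorm2 orbT.
  by rewrite ler_pM ?exprn_ge0 ?(le_trans _ N1) // ler_weXn2l // ltnW.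
have le1 : lognorm (henon q b z) <= ln A + d%:R * lognorm z.
  rewrite /lognorm !logplusE mulr_natl -lnXn ?max1_gt0 // -lnM ?posrE ?exprn_gt0 ?max1_gt0 //.
  by rewrite ler_ln ?posrE ?mulr_gt0 ?exprn_gt0 ?max1_gt0.
have d2' : 2 <= d%:R :> R by rewrite ler_nat.
have C0 : 0 <= log_error r by rewrite /log_error; lra.
have dC : 2 * log_error r <= d%:R * log_error r by rewrite ler_wpM2r.
have AC : ln A <= log_error r by rewrite /log_error; lra.
by rewrite mulrDr; move: le1 dC AC; set u := d%:R * _; set v := d%:R * _; lra.
Qed.

Lemma lognorm_henon_lower r d q b z : radius_ok r -> henon_bound A kappa d q b ->
  trap_region r z ->
  d%:R * (lognorm z - log_error r) <= lognorm (henon q b z) - log_error r.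
Proof.
move=> rok hb zr; have [A0 kk r0] := log_error_terms rok.
have r1 := radius_ge1 rok; have [d2 _ _ _] := hb.
have d2' : 2 <= d%:R :> R by rewrite ler_nat.
set C := log_error r; set l1 := lognorm (henon q b z).
have l10 : 0 <= l1 by exact: lognorm_ge0.
have C0 : 0 <= C by rewrite /C /log_error; lra.
have dC : d%:R * C <= 2 * (d%:R * C - C).
  have : 2 * C <= d%:R * C by rewrite ler_wpM2r.
  by lra.
have d1C : C <= d%:R * C - C.
  have : 2 * C <= d%:R * C by rewrite ler_wpM2r.
  by lra.
rewrite mulrBr; case: zr => [zr|zr].
- have lz : lognorm z <= ln r.
    by rewrite /lognorm logplusE ler_ln ?posrE ?max1_gt0 ?(lt_le_trans _ r1) // ge_max r1.
  have : d%:R * (2 * lognorm z) <= d%:R * C.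
    by rewrite ler_wpM2l // /C /log_error; lra.
  by lra.
- have low := henon_lower rok hb zr; have [rz xy] := zr.
  have y1 : 1 <= normc z.2 by exact: le_trans rz.
  have y0 : 0 < normc z.2 by exact: lt_le_trans y1.
  have -> : lognorm z = ln (normc z.2).
    by rewrite /lognorm /maxnorm (max_r xy) logplusE max_r.
  have : ln kappa + d%:R * ln (normc z.2) <= l1.
    rewrite mulr_natl -lnXn // -lnM ?posrE ?exprn_gt0 //.
    apply: (@le_trans _ _ (ln (normc (henon q b z).2))).
      by rewrite ler_ln ?posrE ?(lt_le_trans _ low) ?mulr_gt0 ?exprn_gt0.
    by rewrite (le_trans (ln_le_logplus _)) // ler_logplus // maxnorm2.
  have : - ln kappa <= C by rewrite /C /log_error; lra.
  by lra.
Qed.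

End growth.
(** * Compositions of Henon steps *)

Section composition.
Variables (R : realType) (I : Type) (dg : I -> nat).
Variables (q : I -> {poly R[i]}) (b : I -> R[i]) (A kappa : R).
Hypotheses (A1 : 1 <= A) (k0 : 0 < kappa) (k1 : kappa <= 1).
Hypothesis hb : forall i, henon_bound A kappa (dg i) (q i) (b i).

Definition henon_fold (s : seq I) (z : C2 R) : C2 R :=
  foldl (fun w j => henon (q j) (b j) w) z s.

Lemma henon_fold_escape r s z : radius_ok A kappa r -> escape_region r z ->
  escape_region r (henon_fold s z) /\
  (kappa * normc z.2) ^+ (\prod_(j <- s) dg j)%N <= kappa * normc (henon_fold s z).2.
Proof.
move=> rok; elim: s z => [|j s IH] z zr /=; first by rewrite big_nil expr1.
have [zr' le1] := henon_escape A1 k0 k1 rok (hb j) zr.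
have [zr'' le2] := IH _ zr'; split => //.
rewrite big_cons exprM (le_trans _ le2) //.
have nk (w : C2 R) : 0 <= kappa * normc w.2 by rewrite mulr_ge0 ?normc_ge0 // ltW.
by rewrite lerXn2r ?nnegrE ?exprn_ge0.
Qed.

Lemma trap_henon_fold r s z : radius_ok A kappa r ->
  trap_region r z -> trap_region r (henon_fold s z).
Proof.
move=> rok; elim: s z => [|j s IH] z zr //=.
by apply: IH; exact: trap_henon (hb j) _.
Qed.

Lemma lognorm_henon_fold_upper r s z : radius_ok A kappa r ->
  lognorm (henon_fold s z) + log_error A kappa r <=
  (\prod_(j <- s) dg j)%N%:R * (lognorm z + log_error A kappa r).
Proof.
move=> rok; elim: s z => [|j s IH] z /=; first by rewrite big_nil mul1r.
apply: le_trans (IH _) _; rewrite big_cons mulnC natrM -mulrA ler_wpM2l //.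
exact: lognorm_henon_upper.
Qed.

Lemma lognorm_henon_fold_lower r s z : radius_ok A kappa r -> trap_region r z ->
  (\prod_(j <- s) dg j)%N%:R * (lognorm z - log_error A kappa r) <=
  lognorm (henon_fold s z) - log_error A kappa r.
Proof.
move=> rok; elim: s z => [|j s IH] z zr /=; first by rewrite big_nil mul1r.
have zr' : trap_region r (henon (q j) (b j) z) by exact: trap_henon (hb j) zr.
apply: le_trans (IH _ zr'); rewrite big_cons mulnC natrM -mulrA ler_wpM2l //.
exact: lognorm_henon_lower.
Qed.

End composition.

(** * The Green function *)

Lemma cvg_expnV (R : realType) (D : nat) (C : R) : (2 <= D)%N ->
  (D%:R ^+ n)^-1 * C @[n --> \oo] --> (0 : R).
Proof.
move=> D2; rewrite -[X in _ --> X](mul0r C); apply: cvgMr_tmp.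
under eq_fun do rewrite -exprVn.
have D0 : 0 < D%:R :> R by rewrite ltr0n ltnW.
by apply: cvg_expr; rewrite gtr0_norm ?invr_gt0 // invf_lt1 // ltr1n.
Qed.

Section green.
Variables (R : realType) (T : Type) (F : T * C2 R -> T * C2 R) (D : nat).
Variables (kappa r0 : R).

(** The interface between Henon maps and the construction of the Green function:
    on each trapped region, [lognorm] is multiplied by [D] up to an error of a
    form that does not accumulate under iteration. *)
Definition growth :=
  [/\ (2 <= D)%N, 0 < kappa, 2 / kappa <= r0,
      (forall r, r0 <= r -> exists2 C, 0 <= C & forall q, trap_region r q.2 ->
        [/\ trap_region r (F q).2,
            D%:R * (lognorm q.2 - C) <= lognorm (F q).2 - C &
            lognorm (F q).2 + C <= D%:R * (lognorm q.2 + C)]) &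
      (forall r q, r0 <= r -> escape_region r q.2 ->
        escape_region r (F q).2 /\
        (kappa * normc q.2.2) ^+ D <= kappa * normc (F q).2.2)].

Definition green_approx (n : nat) (q : T * C2 R) : R :=
  (D%:R ^+ n)^-1 * lognorm (iter n F q).2.

Definition green (q : T * C2 R) : R := lim (green_approx n q @[n --> \oo]).

Hypothesis hF : growth.

Lemma degree_gt0 : 0 < D%:R :> R.
Proof. by have [D2 _ _ _ _] := hF; rewrite ltr0n ltnW. Qed.

Lemma degreeX_gt0 n : 0 < D%:R ^+ n :> R.
Proof. by rewrite exprn_gt0 // degree_gt0. Qed.

Lemma trap_mem (r : R) (q : T * C2 R) : maxnorm q.2 <= r -> trap_region r q.2.
Proof. by left. Qed.

Lemma cvg_degreeV (C : R) : (D%:R ^+ n)^-1 * C @[n --> \oo] --> (0 : R).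
Proof. by have [D2 _ _ _ _] := hF; exact: cvg_expnV. Qed.

Lemma trap_iter r q n : r0 <= r -> trap_region r q.2 ->
  trap_region r (iter n F q).2.
Proof.
have [_ _ _ h _] := hF => /h[C _ hC] qr.
by elim: n => //= n IH; have [] := hC _ IH.
Qed.

(** The corrected sequences [D^-n (lognorm - C)] and [D^-n (lognorm + C)] are
    monotone in opposite directions and their difference tends to 0. *)
Lemma green_rate_cvg r : r0 <= r -> exists2 C, 0 <= C &
  forall q, trap_region r q.2 ->
    green_approx n q @[n --> \oo] --> green q /\
    forall n, `|green_approx n q - green q| <= (D%:R ^+ n)^-1 * C.
Proof.
move=> rr; have [_ _ _ h _] := hF; have [C C0 hC] := h r rr.
exists C => // q qr.
pose a n := (D%:R ^+ n)^-1 * (lognorm (iter n F q).2 - C).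
pose b n := (D%:R ^+ n)^-1 * (lognorm (iter n F q).2 + C).
have stepE n (x : R) : (D%:R ^+ n)^-1 * x = (D%:R ^+ n.+1)^-1 * (D%:R * x).
  by rewrite exprSr invfM -mulrA mulKf // gt_eqF // degree_gt0.
have na : nondecreasing_seq a.
  apply/nondecreasing_seqP => n; rewrite /a stepE ler_wpM2l ?invr_ge0 ?(ltW (degreeX_gt0 _)) //.
  by have [] := hC _ (trap_iter n rr qr).
have nb : nonincreasing_seq b.
  apply/nonincreasing_seqP => n; rewrite /b [leRHS]stepE.
  rewrite ler_wpM2l ?invr_ge0 ?(ltW (degreeX_gt0 _)) //.
  by have [] := hC _ (trap_iter n rr qr).
have ab n : a n <= b n.
  rewrite ler_wpM2l ?invr_ge0 ?(ltW (degreeX_gt0 _)) // lerD2l.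
  by rewrite (le_trans _ C0) // oppr_le0.
have ca : cvgn a.
  apply: nondecreasing_is_cvgn => //; exists (b 0%N) => _ [n _ <-].
  by apply: le_trans (ab n) _; exact: nb.
have uE : green_approx ^~ q = (fun n => a n + (D%:R ^+ n)^-1 * C).
  by apply/funext => n; rewrite /a -mulrDr subrK.
have cu : green_approx n q @[n --> \oo] --> limn a.
  rewrite uE -[X in _ --> X](addr0 (limn a)); apply: cvgD; first exact: ca.
  exact: cvg_degreeV.
have bE : b = (fun n => green_approx n q + (D%:R ^+ n)^-1 * C).
  by apply/funext => n; rewrite /b mulrDr.
have cb : b n @[n --> \oo] --> limn a.
  rewrite bE -[X in _ --> X](addr0 (limn a)); apply: cvgD; first exact: cu.
  exact: cvg_degreeV.
have gE : green q = limn a by exact: cvg_lim.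
split; first by rewrite gE.
move=> n; rewrite gE ler_norml.
have h1 : a n <= limn a by exact: nondecreasing_cvgn_le.
have h2 : limn a <= b n.
  have -> : limn a = limn b by apply/esym; exact: cvg_lim.
  by apply: nonincreasing_cvgn_ge => //; apply/cvg_ex; exists (limn a).
by move: h1 h2; rewrite /a /b mulrBr mulrDr -/(green_approx n q); lra.
Qed.

End green.
(** * Functional equation and zero set *)

Section green_properties.
Variables (R : realType) (T : Type) (F : T * C2 R -> T * C2 R) (D : nat).
Variables (kappa r0 : R).
Hypothesis hF : growth F D kappa r0.

Local Notation u := (green_approx F D).
Local Notation G := (green F D).
Let D0 n : 0 < D%:R ^+ n :> R := degreeX_gt0 hF n.

Lemma green_cvg q : u n q @[n --> \oo] --> G q.
Proof.
have rr : r0 <= Num.max r0 (maxnorm q.2) by rewrite le_max lexx.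
have [C _ /(_ q)[] //] := green_rate_cvg hF rr.
by apply: trap_mem; rewrite le_max lexx orbT.
Qed.

Lemma green_rate (B : R) : exists2 C, 0 <= C & forall q n, maxnorm q.2 <= B ->
  `|u n q - G q| <= (D%:R ^+ n)^-1 * C.
Proof.
have rr : r0 <= Num.max r0 B by rewrite le_max lexx.
have [C C0 hC] := green_rate_cvg hF rr; exists C => // q n qB.
by apply: (hC q _).2; apply: trap_mem; rewrite le_max qB orbT.
Qed.

Lemma green_approx_ge0 n q : 0 <= u n q.
Proof. by rewrite mulr_ge0 ?lognorm_ge0 // invr_ge0 ltW. Qed.

Lemma green_ge0 q : 0 <= G q.
Proof.
rewrite -(cvg_lim _ (@green_cvg q)) //; apply: limr_ge.
  by apply/cvg_ex; exists (G q); exact: green_cvg.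
by apply: nearW => n; exact: green_approx_ge0.
Qed.

Lemma green_functional q : D%:R * G q = G (F q).
Proof.
have h1 : u n (F q) @[n --> \oo] --> G (F q) by exact: green_cvg.
have h2 : D%:R * u n.+1 q @[n --> \oo] --> D%:R * G q.
  apply: cvgMl_tmp; rewrite (cvg_shiftS (u ^~ q)); exact: green_cvg.
have uE n : u n (F q) = D%:R * u n.+1 q.
  rewrite /green_approx -iterSr exprS invfM mulrA mulVKf // gt_eqF //.
  exact: degree_gt0 hF.
move: h1; under eq_fun do rewrite uE.
by move=> h1; rewrite -(cvg_lim _ h2) // -(cvg_lim _ h1).
Qed.

Lemma green_iter n q : G (iter n F q) = D%:R ^+ n * G q.
Proof.
elim: n => [|n IH]; first by rewrite expr0 mul1r.
by rewrite iterS -green_functional IH exprS mulrA.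
Qed.

Lemma escape_iter r q n : r0 <= r -> escape_region r q.2 ->
  escape_region r (iter n F q).2 /\
  (kappa * normc q.2.2) ^+ (D ^ n)%N <= kappa * normc (iter n F q).2.2.
Proof.
have [_ k0 _ _ h] := hF => rr qr.
elim: n => [|n [IHr IH]]; first by rewrite expn0 expr1.
have [r1 le1] := h _ _ rr IHr; split => //.
rewrite expnSr exprM (le_trans _ le1) //.
have nk (w : C2 R) : 0 <= kappa * normc w.2 by rewrite mulr_ge0 ?normc_ge0 // ltW.
by rewrite lerXn2r ?nnegrE ?exprn_ge0.
Qed.

(** With [kappa |y| >= 2] at the start, [kappa |y|] is at least [2 ^ (D ^ n)] after
    [n] steps, which yields the explicit lower bound [ln 2]. *)
Lemma green_escape_gt0 r q : r0 <= r -> kappa <= 1 -> escape_region r q.2 -> 0 < G q.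
Proof.
move=> rr k1 qr; have [_ k0 kr _ _] := hF.
have [rq _] := qr.
have ky2 : 2 <= kappa * normc q.2.2.
  by rewrite mulrC -ler_pdivrMr // (le_trans kr) // (le_trans rr).
have ln2 : 0 < ln 2 :> R by rewrite ln_gt0 // ltr1n.
apply: lt_le_trans ln2 _.
rewrite -(cvg_lim _ (@green_cvg q)) //; apply: limr_ge.
  by apply/cvg_ex; exists (G q); exact: green_cvg.
apply: nearW => n; have [_ le1] := escape_iter n rr qr.
rewrite /green_approx ler_pdivlMl // -natrX mulr_natl.
have y0 : 0 < normc (iter n F q).2.2.
  rewrite -(pmulr_rgt0 _ k0) (lt_le_trans _ le1) // exprn_gt0 //.
  by rewrite (lt_le_trans _ ky2).
have -> : ln 2 *+ (D ^ n) = ln ((2 : R) ^+ (D ^ n)) by rewrite lnXn.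
apply: (@le_trans _ _ (ln (normc (iter n F q).2.2))); last first.
  by rewrite (le_trans (ln_le_logplus _)) // ler_logplus // maxnorm2.
rewrite ler_ln ?posrE ?exprn_gt0 //.
apply: (@le_trans _ _ ((kappa * normc q.2.2) ^+ (D ^ n))).
  by rewrite lerXn2r ?nnegrE // (le_trans _ ky2).
by rewrite (le_trans le1) // ler_piMl // ltW.
Qed.

Lemma green_gt0_of_escape r n q : r0 <= r -> kappa <= 1 ->
  escape_region r (iter n F q).2 -> 0 < G q.
Proof.
move=> rr k1 /(green_escape_gt0 rr k1).
by rewrite green_iter pmulr_rgt0.
Qed.

Definition bounded_fibre_orbit q := exists B : R, forall n, maxnorm (iter n F q).2 <= B.

(** In a trapped region an orbit that never escapes stays in a bidisk. *)
Lemma green_gt0_of_unbounded q : kappa <= 1 -> ~ bounded_fibre_orbit q -> 0 < G q.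
Proof.
move=> k1 ub; set r := Num.max r0 (maxnorm q.2).
have rr : r0 <= r by rewrite le_max lexx.
have qr : trap_region r q.2 by apply: trap_mem; rewrite le_max lexx orbT.
apply/not_notP => Gle; apply: ub; exists r => n.
case: (trap_iter hF n rr qr) => // esc.
by case: Gle; exact: green_gt0_of_escape esc.
Qed.

Lemma green_eq0_of_bounded q : bounded_fibre_orbit q -> G q = 0.
Proof.
move=> [B hB]; apply/eqP; rewrite eq_le green_ge0 andbT.
have h := @cvg_degreeV _ _ _ _ _ _ hF (logplus B).
rewrite -(cvg_lim _ h) // -(cvg_lim _ (@green_cvg q)) //.
apply: ler_lim.
- by apply/cvg_ex; exists (G q); exact: green_cvg.
- by apply/cvg_ex; exists 0.
- apply: nearW => n; rewrite ler_wpM2l ?invr_ge0 ?(ltW (D0 n)) //.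
  exact: ler_logplus.
Qed.

Lemma green_eq0P q : kappa <= 1 -> G q = 0 <-> bounded_fibre_orbit q.
Proof.
move=> k1; split; last exact: green_eq0_of_bounded.
move=> Gq; apply/not_notP => /(green_gt0_of_unbounded k1).
by rewrite Gq ltxx.
Qed.

End green_properties.
(** * Continuity *)

Lemma continuous_compT (X Y Z : topologicalType) (f : X -> Y) (g : Y -> Z) :
  continuous f -> continuous g -> continuous (g \o f).
Proof. by move=> cf cg x; apply: continuous_comp; [exact: cf|exact: cg]. Qed.

Lemma continuous_fst (X Y : topologicalType) : continuous (@fst X Y).
Proof. by move=> x; exact: cvg_fst. Qed.

Lemma continuous_snd (X Y : topologicalType) : continuous (@snd X Y).
Proof. by move=> x; exact: cvg_snd. Qed.

Lemma continuous_pair (X Y Z : topologicalType) (f : X -> Y) (g : X -> Z) :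
  continuous f -> continuous g -> continuous (fun x => (f x, g x)).
Proof. by move=> cf cg x; exact: cvg_pair (cf x) (cg x). Qed.

Lemma continuous_cst (Y Z : topologicalType) (c : Z) : continuous (fun _ : Y => c).
Proof. by move=> x; exact: cvg_cst. Qed.

Section complex_continuity.
Variables (R : realType) (X : topologicalType).
Implicit Types f g : X -> CC R.

Lemma continuousCD f g : continuous f -> continuous g ->
  continuous (fun x => f x + g x : CC R).
Proof. by move=> cf cg x; exact: cvgD (cf x) (cg x). Qed.

Lemma continuousCB f g : continuous f -> continuous g ->
  continuous (fun x => f x - g x : CC R).
Proof. by move=> cf cg x; exact: cvgB (cf x) (cg x). Qed.

Lemma continuousCM f g : continuous f -> continuous g ->
  continuous (fun x => f x * g x : CC R).
Proof. by move=> cf cg x; exact: cvgM (cf x) (cg x). Qed.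

Lemma continuousCV f : (forall x, f x != 0) -> continuous f ->
  continuous (fun x => (f x)^-1 : CC R).
Proof. by move=> f0 cf x; exact: cvgV (f0 x) (cf x). Qed.

Lemma continuousCX f n : continuous f -> continuous (fun x => f x ^+ n : CC R).
Proof.
move=> cf; elim: n => [|n IH].
  rewrite (_ : (fun _ => _) = (fun=> 1)); first exact: continuous_cst.
  by apply/funext => x; rewrite expr0.
rewrite (_ : (fun _ => _) = (fun x => f x * f x ^+ n : CC R)).
  exact: (continuousCM cf IH).
by apply/funext => x; rewrite exprS.
Qed.

Lemma continuousC_sum (n : nat) (F : nat -> X -> CC R) :
  (forall i, continuous (F i)) -> continuous (fun x => \sum_(i < n) F i x : CC R).
Proof.
move=> cF; elim: n => [|n IH].
  rewrite (_ : (fun _ => _) = (fun=> 0)); first exact: continuous_cst.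
  by apply/funext => x; rewrite big_ord0.
rewrite (_ : (fun _ => _) = (fun x => \sum_(i < n) F i x + F n x : CC R)).
  exact: (continuousCD IH (cF n)).
by apply/funext => x; rewrite big_ord_recr.
Qed.

Lemma continuousC_horner (p : X -> {poly R[i]}) n f :
  (forall x, (size (p x) <= n)%N) ->
  (forall i, continuous (fun x => (p x)`_i : CC R)) -> continuous f ->
  continuous (fun x => (p x).[f x] : CC R).
Proof.
move=> sp cp cf.
rewrite (_ : (fun _ => _) = (fun x => \sum_(i < n) (p x)`_i * f x ^+ i : CC R)).
  apply: (@continuousC_sum n (fun i x => (p x)`_i * f x ^+ i : CC R)) => i.
  exact: (continuousCM (cp i) (@continuousCX f i cf)).
by apply/funext => x; rewrite (horner_coef_wide _ (sp x)).
Qed.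

End complex_continuity.

Section continuity.
Variable R : realType.

Lemma continuous_normc : continuous (@ComplexField.Normc.normc R : CC R -> R).
Proof.
move=> x; have FF : Filter (nbhs (x : CC R)) by exact: nbhs_filter.
apply/(@cvgrPdist_le _ _ _ _ FF) => /= e e0; apply/nbhs_ballP.
exists e%:C%C => [|y]; first by rewrite /= ltcR.
rewrite -ball_normE /= normrE ltcR => /ltW; apply: le_trans.
by rewrite ler_norml normcB_ge lerNl opprB normc_distC normcB_ge.
Qed.

Lemma continuous_maxnorm : continuous (@maxnorm R : C2 R -> R).
Proof.
move=> z.
apply: (@continuous_max R (C2 R) (fun z => normc z.1) (fun z => normc z.2)).
  exact: (continuous_compT (@continuous_fst (CC R) (CC R)) continuous_normc).
exact: (continuous_compT (@continuous_snd (CC R) (CC R)) continuous_normc).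
Qed.

Variables (T : topologicalType) (F : T * C2 R -> T * C2 R) (D : nat).
Variables (kappa r0 : R).
Hypothesis hF : growth F D kappa r0.
Hypothesis cF : continuous F.

Lemma continuous_iter n : continuous (iter n F).
Proof.
elim: n => [|n IH]; first by move=> q; exact: cvg_id.
exact: (continuous_compT IH cF).
Qed.

Lemma continuous_maxnorm_snd : continuous (fun q : T * C2 R => maxnorm q.2).
Proof. exact: (continuous_compT (@continuous_snd T (C2 R)) continuous_maxnorm). Qed.

Lemma continuous_green_approx n : continuous (green_approx F D n).
Proof.
have c1 := continuous_compT (@continuous_iter n) continuous_maxnorm_snd.
have c2 : continuous (fun q => lognorm (iter n F q).2).
  exact: (continuous_compT c1 (@continuous_logplus R)).
move=> q; exact: cvgMl_tmp (c2 q).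
Qed.

Lemma small_degreeV (C e : R) : 0 < e -> exists n, (D%:R ^+ n)^-1 * C <= e.
Proof.
move=> e0; have /cvgrPdist_le/(_ _ e0) := @cvg_degreeV _ _ _ _ _ _ hF C.
move=> [n _ hn]; exists n; have /= := hn n (leqnn n).
by rewrite sub0r normrN => /(le_trans (ler_norm _)).
Qed.

Lemma continuous_green : continuous (green F D).
Proof.
move=> q; apply/cvgrPdist_le => /= e e0.
have e30 : 0 < e / 3 by rewrite divr_gt0.
have [C C0 hC] := green_rate hF (maxnorm q.2 + 1).
have [n hn] := small_degreeV C e30.
have near_q (p : T * C2 R) : maxnorm p.2 <= maxnorm q.2 + 1 ->
    `|green_approx F D n p - green F D p| <= e / 3.
  by move=> pB; apply: le_trans (hC _ _ pB) _.
have hq : `|green_approx F D n q - green F D q| <= e / 3.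
  by apply: near_q; rewrite lerDl.
near=> p.
have hp : maxnorm p.2 <= maxnorm q.2 + 1.
  near: p.
  by have /cvgr_le := @continuous_maxnorm_snd q; apply; rewrite ltrDl.
have mid : `|green_approx F D n q - green_approx F D n p| <= e / 3.
  by near: p; apply: cvgr_dist_le => //; exact: continuous_green_approx.
have := near_q p hp; move: mid hq; rewrite !ler_norml => /andP[? ?] /andP[? ?] /andP[? ?].
by lra.
Unshelve. all: by end_near. Qed.

End continuity.

(** * Plurisubharmonicity on the fibres *)

Section submean.
Variable R : realType.

Lemma integral_continuous_EFin (v : R -> R) (a b : R) : continuous v ->
  (\int[@lebesgue_measure R]_(t in `[a, b]) (v t)%:E =
   (\int[@lebesgue_measure R]_(t in `[a, b]) v t)%R%:E)%E.
Proof.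
move=> cv; rewrite /Rintegral fineK //.
apply: (@integrable_fin_num _ _ R) => //.
apply: continuous_compact_integrable; first exact: segment_compact.
exact: continuous_subspaceT.
Qed.

Lemma continuous_cis : continuous (@cis R : R -> CC R).
Proof.
move=> t; have cc : cos s @[s --> t] --> cos t := @continuous_cos R t.
have cs : sin s @[s --> t] --> sin t := @continuous_sin R t.
apply/cvgrPdist_le => /= -[e e'] /=.
rewrite ltcE /= => /andP[/eqP -> e0].
have e20 : 0 < e / 2 by rewrite divr_gt0.
near=> s.
have hc : `|cos t - cos s| <= e / 2 by near: s; exact: cvgr_dist_le.
have hs : `|sin t - sin s| <= e / 2 by near: s; exact: cvgr_dist_le.
rewrite normrE lecR (splitr e); apply: le_trans (lerD hc hs).
set x := cos t - cos s; set y := sin t - sin s.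
have xy : x ^+ 2 + y ^+ 2 <= (`|x| + `|y|) ^+ 2.
  rewrite [leRHS]sqrrD !real_normK ?num_real // addrAC lerDl.
  by rewrite mulrn_wge0 // mulr_ge0.
apply: le_trans (ler_wsqrtr xy) _.
by rewrite sqrtr_sqr ger0_norm ?addr_ge0.
Unshelve. all: by end_near. Qed.


Lemma node_mean_le (f g : R -> R) N : (forall t, f t <= g t) ->
  node_mean f N <= node_mean g N.
Proof. by move=> fg; rewrite ler_wpM2l ?invr_ge0 // ler_sum. Qed.

Lemma node_mean_affine (f : R -> R) (x e : R) N : (0 < N)%N ->
  node_mean (fun t => x * (f t + e)) N = x * (node_mean f N + e).
Proof.
move=> N0; rewrite /node_mean -mulr_sumr big_split /= sumr_const card_ord mulrCA.
by rewrite mulrDr -[e *+ N]mulr_natl mulKf // gt_eqF // ltr0n.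
Qed.

(** The form in which holomorphy on the fibres is used: complex lines, and more
    generally polynomial curves, are mapped to polynomial curves. *)
Definition polynomial_fibres (T : Type) (F : T * C2 R -> T * C2 R) :=
  forall l (X Y : {poly R[i]}), exists l' X' Y',
    forall c, F (l, (X.[c], Y.[c])) = (l', (X'.[c], Y'.[c])).

Lemma polynomial_iter (T : Type) (F : T * C2 R -> T * C2 R) n :
  polynomial_fibres F -> polynomial_fibres (iter n F).
Proof.
move=> pF l X Y; elim: n => [|n [l' [X' [Y' h]]]]; first by exists l, X, Y.
have [l2 [X2 [Y2 h2]]] := pF l' X' Y'.
by exists l2, X2, Y2 => c; rewrite iterS h h2.
Qed.

(** At the centre the maximum of the two functions is one of them, whose own
    sub-mean value inequality suffices. *)
Lemma submean_nodes_lognorm (X Y : {poly R[i]}) (e : R) : 0 < e ->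
  exists N0, forall N, (N0 <= N)%N -> (0 < N)%N ->
    lognorm ((X.[0], Y.[0]) : C2 R) - e <=
    node_mean (fun t => lognorm ((X.[cis t], Y.[cis t]) : C2 R)) N.
Proof.
move=> e0; rewrite {1}/lognorm /maxnorm /= logplus_max.
have [_|_] := leP (logplus (normc X.[0])) (logplus (normc Y.[0])).
- have [N0 h] := submean_nodes_logplus Y e0; exists N0 => N N0N Npos.
  apply: le_trans (h N N0N Npos) _; apply: node_mean_le => t.
  by apply: ler_logplus; exact: (@maxnorm2 R (X.[cis t], Y.[cis t])).
- have [N0 h] := submean_nodes_logplus X e0; exists N0 => N N0N Npos.
  apply: le_trans (h N N0N Npos) _; apply: node_mean_le => t.
  by apply: ler_logplus; exact: (@maxnorm1 R (X.[cis t], Y.[cis t])).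
Qed.


Variables (T : topologicalType) (F : T * C2 R -> T * C2 R) (D : nat).
Variables (kappa r0 : R).
Hypotheses (hF : growth F D kappa r0) (cF : continuous F) (pF : polynomial_fibres F).

(** Along the circle the Green function is uniformly close to
    [D^-n lognorm] of a polynomial curve, so its node means inherit the
    inequality up to [e]. *)
Lemma green_submean l (z w : C2 R) :
  ((green F D (l, z))%:E <= circle_mean (fun z => (green F D (l, z))%:E) z w)%E.
Proof.
pose line (c : CC R) : C2 R := z + c *: w.
have cline : continuous line.
  have c1 (a b : CC R) : continuous (fun c : CC R => a + c * b : CC R).
    apply: continuousCD; first exact: continuous_cst.
    by apply: continuousCM; [move=> c; exact: cvg_id|exact: continuous_cst].
  exact: (continuous_pair (c1 z.1 w.1) (c1 z.2 w.2)).
pose v t := green F D (l, line (cis t)).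
have cv : continuous v.
  have cl := continuous_pair (@continuous_cst (CC R) T l) cline.
  exact: (continuous_compT (continuous_compT continuous_cis cl) (continuous_green hF cF)).
have -> : circle_mean (fun z => (green F D (l, z))%:E) z w =
    ((2 * pi)^-1 * \int[@lebesgue_measure R]_(t in `[0, 2 * pi]) v t)%:E.
  by rewrite EFinM -integral_continuous_EFin.
have p0 : (0 : R) < 2 * pi by rewrite mulr_gt0 // pi_gt0.
rewrite lee_fin ler_pdivlMl //; apply: integral_ge_of_node_mean => // e e0.
have e30 : 0 < e / 3 by rewrite divr_gt0.
have [X [Y lineE]] : exists X Y : {poly R[i]}, forall c, line c = (X.[c], Y.[c]).
  exists (z.1%:P + 'X * w.1%:P), (z.2%:P + 'X * w.2%:P) => c.
  by rewrite !hornerD !hornerM !hornerX !hornerC.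
pose B := maxnorm z + maxnorm w.
have lineB c : normc c <= 1 -> maxnorm (line c) <= B.
  move=> c1; rewrite ge_max; apply/andP; split.
  - apply: le_trans (normcD_le _ _) _; rewrite lerD ?maxnorm1 // normcM.
    by rewrite (le_trans _ (maxnorm1 w)) // ler_piMl ?normc_ge0.
  - apply: le_trans (normcD_le _ _) _; rewrite lerD ?maxnorm2 // normcM.
    by rewrite (le_trans _ (maxnorm2 w)) // ler_piMl ?normc_ge0.
(* The three errors of size [e / 3] are: the approximation at the centre, the
   discrete inequality, and the approximation on the circle. *)
have [C C0 hC] := green_rate hF B.
have [n hn] := small_degreeV hF C e30.
have rate c : normc c <= 1 ->
    `|green_approx F D n (l, line c) - green F D (l, line c)| <= e / 3.
  by move=> c1; apply: le_trans (hC (l, line c) n (lineB c c1)) _.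
have [l' [X' [Y' iterE]]] := polynomial_iter n pF l X Y.
have approxE c : green_approx F D n (l, line c) =
    (D%:R ^+ n)^-1 * lognorm ((X'.[c], Y'.[c]) : C2 R).
  by rewrite /green_approx lineE iterE.
have [N0 hN0] := submean_nodes_lognorm X' Y' e30.
exists N0 => N N0N Npos; have := hN0 N N0N Npos.
have D1 : 1 <= D%:R ^+ n :> R.
  by rewrite exprn_ege1 // ler1n; have [D2 _ _ _ _] := hF; exact: ltnW.
have Dpos : 0 < D%:R ^+ n :> R by exact: lt_le_trans D1.
set L0 := lognorm _; set x := D%:R ^+ n in D1 Dpos approxE *.
have mean_le : node_mean (fun t => lognorm ((X'.[cis t], Y'.[cis t]) : C2 R)) N <=
    x * (node_mean v N + e / 3).
  rewrite -node_mean_affine //; apply: node_mean_le => t.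
  rewrite -ler_pdivrMl // -approxE.
  have := rate (cis t); rewrite normc_cis => /(_ (lexx _)).
  by rewrite ler_norml /v => /andP[_]; lra.
have centre : green F D (l, z) - e / 3 <= x^-1 * L0.
  have := rate 0; rewrite normc0 => /(_ ler01).
  by rewrite approxE /line scale0r addr0 ler_norml => /andP[]; rewrite -/L0; lra.
move=> hL; have : x^-1 * (L0 - e / 3) <= node_mean v N + e / 3.
  by rewrite ler_pdivrMl // (le_trans hL).
have : x^-1 * (e / 3) <= e / 3 by rewrite ler_piMl ?(ltW e30) // invf_le1.
by rewrite mulrBr; move: centre; lra.
Qed.

End submean.
(** * Transport by the exchange of coordinates *)

Section package.
Variables (R : realType) (T : topologicalType).
Implicit Types (F : T * C2 R -> T * C2 R) (G : T * C2 R -> R).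

(** The conclusions in a form invariant under the exchange of coordinates: the
    maximum norm replaces the Euclidean one, and uniform convergence on compact
    sets is replaced by a rate on bidisks. *)
Definition green_package F (D : nat) G :=
  [/\ forall B : R, exists C, forall q n, maxnorm q.2 <= B ->
        `|green_approx F D n q - G q| <= (D%:R ^+ n)^-1 * C,
      continuous G,
      forall l z w, ((G (l, z))%:E <= circle_mean (fun z => (G (l, z))%:E) z w)%E,
      forall q, D%:R * G q = G (F q) &
      forall q, 0 <= G q /\ (G q = 0 <-> bounded_fibre_orbit F q)].

Lemma growth_green_package F D kappa r0 : kappa <= 1 -> growth F D kappa r0 ->
  continuous F -> polynomial_fibres F -> green_package F D (green F D).
Proof.
move=> k1 hF cF pF; split.
- by move=> B; have [C _ hC] := green_rate hF B; exists C.
- exact: continuous_green hF cF.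
- exact: green_submean hF cF pF.
- exact: green_functional hF.
- by move=> q; split; [exact: (green_ge0 hF)|exact: (green_eq0P hF)].
Qed.

Definition swap (z : C2 R) : C2 R := (z.2, z.1).

Definition swap_fibre (q : T * C2 R) : T * C2 R := (q.1, swap q.2).

Lemma swapK : involutive swap.
Proof. by case. Qed.

Lemma swap_fibreK : involutive swap_fibre.
Proof. by move=> [l [x y]]. Qed.

Lemma swap_line (z w : C2 R) (c : R[i]) : swap (z + c *: w) = swap z + c *: swap w.
Proof. by []. Qed.

Lemma circle_mean_swap (u : C2 R -> \bar R) (z w : C2 R) :
  circle_mean (fun z => u (swap z)) z w = circle_mean u (swap z) (swap w).
Proof.
by rewrite /circle_mean; congr (_ * _)%E; apply: eq_integral => t _; rewrite swap_line.
Qed.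

Lemma maxnorm_swap (z : C2 R) : maxnorm (swap z) = maxnorm z.
Proof. by rewrite /maxnorm maxC. Qed.

Lemma continuous_swap_fibre : continuous swap_fibre.
Proof.
apply: continuous_pair; first exact: continuous_fst.
have c2 := @continuous_snd T (C2 R).
apply: continuous_pair.
  exact: (continuous_compT c2 (@continuous_snd (CC R) (CC R))).
exact: (continuous_compT c2 (@continuous_fst (CC R) (CC R))).
Qed.

Lemma green_package_swap F F' D G :
  (forall q, F' q = swap_fibre (F (swap_fibre q))) ->
  green_package F D G -> green_package F' D (G \o swap_fibre).
Proof.
move=> F'E [rateF cG smG fG G0].
have iterE n q : iter n F' q = swap_fibre (iter n F (swap_fibre q)).
  elim: n => [|n IH]; first by rewrite swap_fibreK.
  by rewrite !iterS IH F'E swap_fibreK.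
have approxE n q : green_approx F' D n q = green_approx F D n (swap_fibre q).
  by rewrite /green_approx iterE /lognorm maxnorm_swap.
split.
- move=> B; have [C hC] := rateF B; exists C => q n qB.
  by rewrite approxE; apply: hC; rewrite maxnorm_swap.
- exact: (continuous_compT continuous_swap_fibre cG).
- move=> l z w; rewrite (circle_mean_swap (fun z => (G (l, z))%:E)); exact: smG.
- by move=> q /=; rewrite F'E swap_fibreK fG.
- move=> q /=; have [G0q G0P] := G0 (swap_fibre q); split => //.
  rewrite G0P; split => -[B hB]; exists B => n.
    by rewrite iterE maxnorm_swap.
  by have := hB n; rewrite iterE maxnorm_swap.
Qed.

End package.

(** * Compact parameter spaces *)

Section compact_parameter.
Variables (R : realType) (k : nat) (M : set 'rV[CC R]_k) (cptM : compact M).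

Lemma continuous_ubound (f : M -> R) : continuous f -> exists B, forall l, f l <= B.
Proof.
move=> /(@subspace_valL_continuousP' _ _ _ (0 : R) f) cf.
have /compact_bounded[B [_ hB]] := continuous_compact cf cptM.
exists (B + 1) => l; apply: le_trans (ler_norm _) _.
apply: (hB (B + 1)); first by rewrite ltrDl.
exists (set_val l); first exact: set_valP.
by rewrite -[in RHS](@valLK _ _ (0 : R) M f).
Qed.

(** The parameter contributes a bounded amount to the norm. *)
Lemma norm_CkC2_bound : exists2 K : R, 1 <= K &
  forall q : M * C2 R, norm_CkC2 q <= K * Num.max 1 (maxnorm q.2).
Proof.
have hB i : exists B, forall l : M, normc (set_val l 0 i) <= B.
  apply: continuous_ubound.
  have c1 : continuous (fun l : M => set_val l 0 i : CC R).
    have ci : continuous (fun x : 'rV[CC R]_k => x 0 i : CC R).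
      exact: (@coord_continuous (CC R)).
    exact: (continuous_compT (@initial_continuous M _ set_val) ci).
  exact: (continuous_compT c1 (@continuous_normc R)).
have [B {}hB] := choice hB.
pose S := \sum_(i < k) B i ^+ 2.
have S0 : 0 <= S by apply: sumr_ge0 => i _; exact: sqr_ge0.
exists (Num.sqrt (S + 2)).
  by rewrite -[leLHS]sqrtr1 ler_wsqrtr //; lra.
move=> q; set N := Num.max 1 _.
have N1 : 1 <= N by rewrite le_max lexx.
have N0 : 0 <= N by exact: le_trans N1.
have -> : Num.sqrt (S + 2) * N = Num.sqrt ((S + 2) * N ^+ 2).
  by rewrite sqrtrM ?sqrtr_sqr ?ger0_norm //; lra.
apply: ler_wsqrtr; rewrite -addrA mulrDl lerD //.
  apply: (@le_trans _ _ S).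
    apply: ler_sum => i _.
    by rewrite lerXn2r ?nnegrE ?normc_ge0 ?(le_trans _ (hB i q.1)) ?normc_ge0.
  by rewrite ler_peMr // exprn_ege1.
rewrite mulr_natl mulr2n lerD //.
  by rewrite lerXn2r ?nnegrE ?normc_ge0 // /N le_max maxnorm1 orbT.
by rewrite lerXn2r ?nnegrE ?normc_ge0 // /N le_max maxnorm2 orbT.
Qed.

Lemma maxnorm_le_norm_CkC2 (q : M * C2 R) : maxnorm q.2 <= norm_CkC2 q.
Proof.
have S0 : 0 <= \sum_(i < k) normc (set_val q.1 0 i) ^+ 2.
  by apply: sumr_ge0 => i _; exact: sqr_ge0.
have x0 := sqr_ge0 (normc q.2.1); have y0 := sqr_ge0 (normc q.2.2).
rewrite ge_max; apply/andP; split.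
  rewrite -[leLHS]ger0_norm ?normc_ge0 // -sqrtr_sqr; apply: ler_wsqrtr; lra.
rewrite -[leLHS]ger0_norm ?normc_ge0 // -sqrtr_sqr; apply: ler_wsqrtr; lra.
Qed.

Lemma logplus_norm_dist : exists C : R, forall q : M * C2 R,
  `|logplus (norm_CkC2 q) - lognorm q.2| <= C.
Proof.
have [K K1 hK] := norm_CkC2_bound.
have K0 : 0 < K by exact: lt_le_trans K1.
exists (ln K) => q; have h1 := ler_logplus (maxnorm_le_norm_CkC2 q).
rewrite -/(lognorm q.2) in h1.
rewrite ger0_norm ?subr_ge0 // lerBlDr /lognorm [X in _ + X]logplusE.
rewrite logplusE -lnM ?posrE ?max1_gt0 // ler_ln ?posrE ?mulr_gt0 ?max1_gt0 //.
rewrite ge_max hK andbT -[leLHS]mulr1 ler_pM // le_max lexx //.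
Qed.

Lemma bounded_orbitsP (F : M * C2 R -> M * C2 R) q :
  bounded_orbits F q <-> bounded_fibre_orbit F q.
Proof.
split=> -[B hB].
  by exists B => n; apply: le_trans (maxnorm_le_norm_CkC2 _) (hB n).
have [K K1 hK] := norm_CkC2_bound.
exists (K * Num.max 1 B) => n; apply: le_trans (hK _) _.
rewrite ler_wpM2l ?(le_trans _ K1) // ge_max !le_max lexx /=.
by rewrite hB orbT.
Qed.

Lemma green_package_conclusion (F : M * C2 R -> M * C2 R) D G : (2 <= D)%N ->
  green_package F D G ->
  [/\ {family compact, green_seq D F @ \oo --> G},
      continuous G /\ fibre_psh G,
      forall q, D%:R * G q = G (F q),
      forall q, ~ bounded_orbits F q -> 0 < G q &
      forall q, G q = 0 <-> bounded_orbits F q].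
Proof.
move=> D2 [rateF cG smG fG G0].
have G0P q : G q = 0 <-> bounded_orbits F q.
  by rewrite bounded_orbitsP; have [] := G0 q.
split => //.
- apply/fam_cvgP => A cA P /uniform_nbhs[E [entE subP]].
  have [/= e e0 eE] : exists2 e : R, 0 < e & forall x y : R, `|x - y| < e -> E (x, y).
    move: entE; rewrite -entourage_ballE => -[e /= e0 sub]; exists e => // x y xy.
    exact: sub.
  have [B hB] : exists B, forall q, A q -> maxnorm q.2 <= B.
    have cN : {within A, continuous (fun q : M * C2 R => maxnorm q.2)}.
      apply: continuous_subspaceT.
      exact: (continuous_compT (@continuous_snd M (C2 R)) (@continuous_maxnorm R)).
    have /compact_bounded[B [_ hB]] := continuous_compact cN cA.
    exists (B + 1) => q Aq; apply: le_trans (ler_norm _) _.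
    by apply: (hB (B + 1)); [rewrite ltrDl|exists q].
  have [C hC] := rateF B; have [C' hC'] := logplus_norm_dist.
  have D0 n : 0 < D%:R ^+ n :> R by rewrite exprn_gt0 // ltr0n ltnW.
  have /cvgr_lt/(_ e e0)[N _ hN] := @cvg_expnV R D (C + C') D2.
  exists N => // n Nn; apply: subP => q Aq; apply: eE.
  apply: le_lt_trans (hN n Nn); rewrite distrC.
  rewrite -(subrKA (green_approx F D n q)) mulrDr addrC.
  rewrite (le_trans (ler_normD _ _)) // lerD //; first exact: hC (hB q Aq).
  rewrite /green_seq /green_approx -mulrBr normrM gtr0_norm ?invr_gt0 //.
  by rewrite ler_wpM2l ?invr_ge0 ?(ltW (D0 n)).
- split=> // l; split => //.
  + by move=> z; rewrite ltry.
  + have cl : continuous (fun z : C2 R => G (l, z)).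
      exact: (continuous_compT (continuous_pair (@continuous_cst (C2 R) M l)
        (fun z => @cvg_id _ (nbhs z))) cG).
    move=> z a /=; rewrite lte_fin ltrNr => az.
    exists [set y | G (l, y) < - a]; first exact: (cvgr_lt _ (cl z) _ az).
    by move=> y /= ya; rewrite lte_fin ltrNr.
- move=> q nb; have [G0q _] := G0 q; rewrite lt_neqAle G0q andbT eq_sym.
  by apply/eqP => /G0P.
Qed.

End compact_parameter.
(** * Fibred families of Henon maps *)

Section fibred_family.
Variables (R : realType) (T : Type) (I : Type).
Variables (tau : T -> T) (q : I -> T -> {poly R[i]}) (b : I -> T -> CC R).

Definition fibred_fold (s : seq I) (p : T * C2 R) : T * C2 R :=
  (tau p.1, henon_fold (q ^~ p.1) (b ^~ p.1) s p.2).

Lemma polynomial_fibred_fold s : polynomial_fibres (fibred_fold s).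
Proof.
move=> l X Y; suff [X' [Y' h]] : exists X' Y' : {poly R[i]}, forall c,
    henon_fold (q ^~ l) (b ^~ l) s (X.[c], Y.[c]) = (X'.[c], Y'.[c]).
  by exists (tau l), X', Y' => c; rewrite /fibred_fold h.
elim: s X Y => [|j s IH] X Y; first by exists X, Y.
have [X' [Y' h]] := IH Y (q j l \Po Y - (b j l)%:P * X).
exists X', Y' => c; rewrite -h /= /henon /=.
by rewrite hornerD hornerN hornerM hornerC horner_comp.
Qed.

Variables (dg : I -> nat) (A kappa : R).
Hypotheses (A1 : 1 <= A) (k0 : 0 < kappa) (k1 : kappa <= 1).
Hypothesis dg2 : forall j, (2 <= dg j)%N.
Hypothesis hb : forall j l, henon_bound A kappa (dg j) (q j l) (b j l).

Lemma growth_fibred_fold s : (0 < size s)%N ->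
  growth (fibred_fold s) (\prod_(j <- s) dg j)%N kappa
    (Num.max (A / kappa) (2 / kappa)).
Proof.
move=> s0; have rok r : Num.max (A / kappa) (2 / kappa) <= r -> radius_ok A kappa r.
  by rewrite ge_max => /andP[].
split => //.
- case: s s0 => // j s _; rewrite big_cons -[2%N]muln1 leq_mul //.
  by apply: prodn_gt0 => i; exact: ltnW.
- by rewrite le_max lexx orbT.
- move=> r /rok rr; exists (log_error A kappa r).
    have [? ? ?] := log_error_terms A1 k0 k1 rr; rewrite /log_error; lra.
  move=> p pr; have hbl j := hb j p.1; split.
  + exact: (trap_henon_fold A1 k0 k1 hbl).
  + exact: (lognorm_henon_fold_lower A1 k0 k1 hbl).
  + exact: (lognorm_henon_fold_upper A1 k0 k1 hbl).
- move=> r p /rok rr pr.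
  exact: (henon_fold_escape A1 k0 k1 (fun j => hb j p.1)).
Qed.

End fibred_family.

Section continuous_family.
Variables (R : realType) (T : topologicalType) (I : Type).
Variables (tau : T -> T) (q : I -> T -> {poly R[i]}) (b : I -> T -> CC R).
Variable (dg : I -> nat).
Hypothesis tau_cont : continuous tau.
Hypothesis q_size : forall j l, (size (q j l) <= (dg j).+1)%N.
Hypothesis q_cont : forall j i, continuous (fun l => (q j l)`_i : CC R).
Hypothesis b_cont : forall j, continuous (b j).

Lemma continuous_henon_fold s (X : topologicalType) (lam : X -> T) (w : X -> C2 R) :
  continuous lam -> continuous w ->
  continuous (fun x => henon_fold (q ^~ (lam x)) (b ^~ (lam x)) s (w x)).
Proof.
move=> clam; elim: s w => [|j s IH] w cw; first exact: cw.
apply: (IH (fun x => henon (q j (lam x)) (b j (lam x)) (w x))).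
have c1 := continuous_compT cw (@continuous_fst (CC R) (CC R)).
have c2 := continuous_compT cw (@continuous_snd (CC R) (CC R)).
have cq i : continuous (fun x => (q j (lam x))`_i : CC R).
  exact: (continuous_compT clam (@q_cont j i)).
have cb : continuous (fun x => b j (lam x)).
  exact: (continuous_compT clam (@b_cont j)).
have ch := @continuousC_horner R X (fun x => q j (lam x)) (dg j).+1
  (fun x => (w x).2) (fun x => q_size j (lam x)) cq c2.
exact: (continuous_pair c2 (continuousCB ch (continuousCM cb c1))).
Qed.

Lemma continuous_fibred_fold s : continuous (fibred_fold tau q b s).
Proof.
have c1 := @continuous_fst T (C2 R); have c2 := @continuous_snd T (C2 R).
exact: (continuous_pair (continuous_compT c1 tau_cont) (@continuous_henon_fold s _ fst snd c1 c2)).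
Qed.

End continuous_family.

Section uniform_bounds.
Variables (R : realType) (k : nat) (M : set 'rV[CC R]_k) (cptM : compact M).
Variables (I : finType) (dg : I -> nat).
Variables (q : I -> M -> {poly R[i]}) (b : I -> M -> CC R).
Hypothesis dg2 : forall j, (2 <= dg j)%N.
Hypothesis q_size : forall j l, (size (q j l) <= (dg j).+1)%N.
Hypothesis q_lead : forall j l, (q j l)`_(dg j) != 0.
Hypothesis q_cont : forall j i, continuous (fun l => (q j l)`_i : CC R).
Hypothesis b_cont : forall j, continuous (b j).

Lemma normc_ubound (f : M -> CC R) : continuous f -> exists B, forall l, normc (f l) <= B.
Proof.
move=> cf; apply: (continuous_ubound cptM).
exact: (continuous_compT cf (@continuous_normc R)).
Qed.

(** The lower bound on the leading coefficients comes from an upper bound on their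
    inverses, which are continuous as well. *)
Lemma uniform_henon_bound : exists A kappa : R,
  [/\ 1 <= A, 0 < kappa, kappa <= 1 &
      forall j l, henon_bound A kappa (dg j) (q j l) (b j l)].
Proof.
have hA j : exists A : R, forall l,
    \sum_(i < (dg j).+1) normc (q j l)`_i + normc (b j l) <= A.
  have [c hc] := choice (fun i => normc_ubound (@q_cont j i)).
  have [B hB] := normc_ubound (@b_cont j).
  exists (\sum_(i < (dg j).+1) c i + B) => l.
  by rewrite lerD // ler_sum.
have [a ha] := choice hA.
have [e he] := choice (fun j => normc_ubound (continuousCV (q_lead j) (@q_cont j (dg j)))).
have sum_ge (c : I -> R) j : c j <= \sum_i `|c i|.
  by rewrite (bigD1 j) //= (le_trans (ler_norm _)) // lerDl sumr_ge0.
have sum0 (c : I -> R) : 0 <= \sum_i `|c i| by rewrite sumr_ge0.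
pose K := 2 * (1 + \sum_i `|e i|).
have K2 : 2 <= K by rewrite /K; have := sum0 e; lra.
have K0 : 0 < K by exact: lt_le_trans K2.
exists (1 + \sum_i `|a i|), K^-1; split.
- by rewrite lerDl.
- by rewrite invr_gt0.
- by rewrite invf_le1 // (le_trans _ K2) // ler1n.
move=> j l; split => //.
- have lead0 : 0 < normc (q j l)`_(dg j) by rewrite normc_gt0.
  rewrite ler_pdivrMr //.
  have := he j l; rewrite normcV => el.
  have h1 : (normc (q j l)`_(dg j))^-1 <= K / 2.
    rewrite /K mulrC mulKf //; apply: le_trans el _.
    by rewrite (le_trans (sum_ge e j)) // lerDr.
  have : 1 <= (normc (q j l)`_(dg j)) * (K / 2).
    by rewrite -ler_pdivrMl // mulr1.
  by lra.
- by rewrite (le_trans (ha j l)) // (le_trans (sum_ge a j)) // lerDr.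
Qed.

End uniform_bounds.
Section green_of_fold.
Variables (R : realType) (k : nat) (M : set 'rV[CC R]_k) (cptM : compact M).
Variables (I : finType) (dg : I -> nat) (tau : M -> M).
Variables (q : I -> M -> {poly R[i]}) (b : I -> M -> CC R).

Lemma green_package_fibred_fold (s : seq I) : (0 < size s)%N ->
  continuous tau -> (forall j, (2 <= dg j)%N) ->
  (forall j l, (size (q j l) <= (dg j).+1)%N) ->
  (forall j l, (q j l)`_(dg j) != 0) ->
  (forall j i, continuous (fun l => (q j l)`_i : CC R)) ->
  (forall j, continuous (b j)) ->
  exists G, green_package (fibred_fold tau q b s) (\prod_(j <- s) dg j)%N G.
Proof.
move=> s0 ctau dg2 qsize qlead qcont bcont.
have [A [kappa [A1 k0 k1 hb]]] := uniform_henon_bound cptM dg2 qsize qlead qcont bcont.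
have hF := growth_fibred_fold tau A1 k0 k1 dg2 hb s0.
exists (green (fibred_fold tau q b s) (\prod_(j <- s) dg j)%N).
apply: (growth_green_package k1 hF).
- exact: continuous_fibred_fold ctau qsize qcont bcont _.
- exact: polynomial_fibred_fold.
Qed.

End green_of_fold.

(** * Forward and backward Green functions *)

Lemma henon_inv_swap (R : realType) (p : {poly R[i]}) (a : R[i]) (z : C2 R) :
  henon_inv p a z = swap (henon (a^-1 *: p) a^-1 (swap z)).
Proof.
by rewrite /henon_inv /henon /swap /= hornerZ -mulrBr mulrC.
Qed.

(** Inversion reverses the order of the factors. *)
Lemma henon_comp_inv_swap (R : realType) m (ps : 'I_m -> {poly R[i]})
    (cs : 'I_m -> R[i]) (z : C2 R) :
  henon_comp_inv ps cs z =
  swap (henon_fold (fun j => (cs j)^-1 *: ps j) (fun j => (cs j)^-1)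
    (rev (enum 'I_m)) (swap z)).
Proof.
rewrite /henon_fold foldl_rev /henon_comp_inv.
by elim: (enum _) => [|j s IH] /=; rewrite ?swapK // henon_inv_swap IH swapK.
Qed.

Theorem proposition1p11 (R : realType) (k : nat) (hk : (1 <= k)%N)
    (M : set 'rV[CC R]_k) (cptM : compact M)
    (sigma sigmaV : M -> M)
    (sigmaK : cancel sigma sigmaV) (sigmaVK : cancel sigmaV sigma)
    (sigma_cont : continuous sigma) (sigmaV_cont : continuous sigmaV)
    (m : nat) (hm : (1 <= m)%N)
    (dg : 'I_m -> nat) (hdg : forall j, (2 <= dg j)%N)
    (p : 'I_m -> M -> {poly R[i]})
    (p_monic : forall j l, p j l \is monic)
    (p_degree : forall j l, size (p j l) = (dg j).+1)
    (p_cont : forall j i, continuous (fun l : M => (p j l)`_i : CC R))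
    (a : 'I_m -> M -> CC R)
    (a_cont : forall j, continuous (a j))
    (a_neq0 : forall j l, a j l != 0) :
  let d := (\prod_(j < m) dg j)%N in
  let H := fibred_henon sigma p a in
  let HV := fibred_henon_inv sigmaV p a in
  (exists Gp : M * C2 R -> R,
     [/\ {family compact, green_seq d H @ \oo --> Gp},
         continuous Gp /\ fibre_psh Gp,
         forall q, d%:R * Gp q = Gp (H q),
         forall q, ~ bounded_orbits H q -> 0 < Gp q &
         forall q, Gp q = 0 <-> bounded_orbits H q]) /\
  (exists Gm : M * C2 R -> R,
     [/\ {family compact, green_seq d HV @ \oo --> Gm},
         continuous Gm /\ fibre_psh Gm,
         forall q, d%:R * Gm q = Gm (HV q),
         forall q, ~ bounded_orbits HV q -> 0 < Gm q &
         forall q, Gm q = 0 <-> bounded_orbits HV q]).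
Proof.
move=> d H HV.
have d2 : (2 <= d)%N.
  case: m hm dg hdg @d {p p_monic p_degree p_cont a a_cont a_neq0 H HV} => // m' _ dg hdg /=.
  rewrite big_ord_recl -[2%N]muln1 leq_mul //.
  by apply: prodn_gt0 => i; exact: ltnW.
have enum0 : (0 < size (enum 'I_m))%N by rewrite size_enum_ord.
have lead1 j l : (p j l)`_(dg j) = 1.
  by have := monicP (p_monic j l); rewrite lead_coefE p_degree.
have prodE : (\prod_(j <- enum 'I_m) dg j)%N = d by rewrite big_enum.
split.
- have psize j l : (size (p j l) <= (dg j).+1)%N by rewrite p_degree.
  have plead j l : (p j l)`_(dg j) != 0 by rewrite lead1 oner_eq0.
  have [G pkG] := green_package_fibred_fold cptM enum0 sigma_cont hdg psize
    plead p_cont a_cont.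
  rewrite prodE in pkG.
  exists G; exact: (green_package_conclusion cptM d2 pkG).
- pose b j l : CC R := (a j (sigmaV l))^-1.
  pose q j l : {poly R[i]} := b j l *: p j (sigmaV l).
  have b_neq0 j l : b j l != 0 by rewrite invr_eq0.
  have b_cont j : continuous (b j).
    apply: continuousCV; first by move=> l.
    exact: (continuous_compT sigmaV_cont (@a_cont j)).
  have qsize j l : (size (q j l) <= (dg j).+1)%N by rewrite size_scale // p_degree.
  have qlead j l : (q j l)`_(dg j) != 0 by rewrite coefZ lead1 mulr1.
  have qcont j i : continuous (fun l => (q j l)`_i : CC R).
    rewrite (_ : (fun _ => _) = (fun l => b j l * (p j (sigmaV l))`_i : CC R)).
      exact: (continuousCM (@b_cont j) (continuous_compT sigmaV_cont (@p_cont j i))).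
    by apply/funext => l; rewrite coefZ.
  have rev0 : (0 < size (rev (enum 'I_m)))%N by rewrite size_rev.
  have [G] := green_package_fibred_fold cptM rev0 sigmaV_cont hdg qsize qlead qcont b_cont.
  have -> : (\prod_(j <- rev (enum 'I_m)) dg j)%N = d.
    by rewrite -prodE; apply: perm_big; rewrite perm_rev.
  move=> pkG; exists (G \o @swap_fibre R M).
  apply: (green_package_conclusion cptM d2); apply: green_package_swap pkG => x.
  by rewrite /HV /fibred_henon_inv henon_comp_inv_swap.
Qed.
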